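(* Let $n\ge2$ and let $B_3(A_n)[1,\ldots,1]$ denote the subspace of $B_3(A_n)$ of degree 1 in each generator $x_1,\dots,x_n$. Then $$\dim B_3(A_n)[1,\ldots,1]=(n-2)2^{n-2}.$$
   Context: The ground field is $\mathbb{C}$ (or any field of characteristic zero in its place). $A=A_n$ is the free unital associative algebra on $x_1,\ldots,x_n$, with its natural grading by $(\mathbb{Z}_{\ge0})^n$ (degree in each generator). For subspaces $P,Q$, $[P,Q]$ is the span of commutators. Put $L_1=A$, $L_{m+1}=[A,L_m]$, $B_m(A_n)=L_m/L_{m+1}$, with the induced $(\mathbb{Z}_{\ge0})^n$-grading. *)

(* Defs.v *)
From HB Require Import structures.
From mathcomp Require Import all_boot all_algebra.
From mathcomp Require Import finmap monalg boolp.

Set Implicit Arguments.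
Unset Strict Implicit.
Unset Printing Implicit Defensive.

Import GRing.Theory.
Local Open Scope ring_scope.

Section Spans.
Context (K : fieldType) (V : lmodType K).
Implicit Types (S U : {pred V}).

(* Subspaces are not assumed to be finite-dimensional or decidable;
   membership is made boolean classically. *)
Definition lspan S : {pred V} := fun v =>
  `[< exists (k : nat) (c : 'I_k -> K) (s : 'I_k -> V),
        (forall i, s i \in S) /\ v = \sum_(i < k) c i *: s i >].

Lemma lspan_submod S : submod_closed (lspan S).
Proof.
split; first by apply/asboolP; exists 0%N, (fun=> 0), (fun=> 0); split=> [[]|] //;
  rewrite big_ord0.
move=> a u v /asboolP[k [c [s [sS ->]]]] /asboolP[l [d [t [tS ->]]]].
apply/asboolP; exists (k + l)%N.
exists (fun i => match split i with inl j => a * c j | inr j => d j end).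
exists (fun i => match split i with inl j => s j | inr j => t j end).
split=> [i|]; first by case: (split i).
rewrite big_split_ord /= scaler_sumr; congr (_ + _); apply: eq_bigr => i _.
  by rewrite -[lshift l i]/(unsplit (inl i)) unsplitK scalerA.
by rewrite -[rshift k i]/(unsplit (inr i)) unsplitK.
Qed.

HB.instance Definition _ S :=
  GRing.isSubmodClosed.Build K V (lspan S) (lspan_submod S).

Definition has_dim U (d : nat) : Prop :=
  exists e : 'I_d -> V,
    [/\ forall i, e i \in U,
        forall c : 'I_d -> K, \sum_i c i *: e i = 0 -> forall i, c i = 0
      & forall u, u \in U -> exists c : 'I_d -> K, u = \sum_i c i *: e i].

End Spans.

Section QuotientSpace.
Context (K : fieldType) (V : lmodType K) (W : submodClosed V).

(* Quotient.quot takes a zmodClosed predicate and submodClosed does not inherit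
   from it. *)
Definition qker : {pred V} := W.
HB.instance Definition _ :=
  GRing.isZmodClosed.Build V qker (GRing.submod_closedB (submodClosedP W)).

(* Quotient.quot is only a zmodType; the K-module structure is added on an
   alias indexed by the subspace. *)
Definition quotmod : Type := Quotient.quot qker.
HB.instance Definition _ := GRing.Zmodule.on quotmod.

Definition qproj (v : V) : quotmod := (\pi_(Quotient.quot qker) v)%qT.

Definition qscale (a : K) (x : quotmod) : quotmod :=
  qproj (a *: generic_quotient.repr (x : Quotient.quot qker)).

Lemma qprojP (x : quotmod) : exists v, x = qproj v.
Proof. by exists (generic_quotient.repr (x : Quotient.quot qker)); rewrite /qproj reprK. Qed.

Lemma qproj_eq u v : (qproj u == qproj v) = (u - v \in W).
Proof. by rewrite -[RHS]/(u - v \in qker) Quotient.idealrBE. Qed.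

Lemma qprojD : {morph qproj : u v / u + v}.
Proof. by move=> u v; rewrite /qproj; exact: Quotient.pi_add. Qed.

Lemma qscaleE a v : qscale a (qproj v) = qproj (a *: v).
Proof.
apply/eqP; rewrite qproj_eq -scalerBr rpredZ // -qproj_eq.
by rewrite /qproj reprK.
Qed.

Fact qscaleA a b x : qscale a (qscale b x) = qscale (a * b) x.
Proof. by case: (qprojP x) => v ->; rewrite !qscaleE scalerA. Qed.
Fact qscale1 : left_id 1 qscale.
Proof. by move=> x; case: (qprojP x) => v ->; rewrite qscaleE scale1r. Qed.
Fact qscaleDr : right_distributive qscale +%R.
Proof.
move=> a x y; case: (qprojP x) => u ->; case: (qprojP y) => v ->.
by rewrite -qprojD !qscaleE scalerDr qprojD.
Qed.
Fact qscaleDl x : {morph qscale^~ x : a b / a + b}.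
Proof.
by move=> a b; case: (qprojP x) => v ->; rewrite !qscaleE scalerDl qprojD.
Qed.

HB.instance Definition _ := GRing.Zmodule_isLmodule.Build K quotmod
  qscaleA qscale1 qscaleDr qscaleDl.

Lemma qproj_is_linear : linear qproj.
Proof. by move=> a u v; rewrite qprojD -qscaleE. Qed.

Definition qimage (S : {pred V}) : {pred quotmod} :=
  fun y => `[< exists2 v, v \in S & y = qproj v >].

End QuotientSpace.

Arguments qimage {K V} W S _ : rename.

Section FreeAlgebra.
Context (K : fieldType) (n : nat).

(* The monoid algebra of the free monoid on n letters. *)
Definition freealg : Type := {malg K[{fmonom 'I_n}]}.
HB.instance Definition _ := GRing.Lalgebra.on freealg.

(* Degree-d part, where d i is the degree in the i-th generator: every word
   w in the support has exactly d i occurrences of the letter i. *)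
Definition homog (d : 'I_n -> nat) : {pred freealg} := fun a =>
  all (fun w : {fmonom 'I_n} => [forall i, count_mem i w == d i])
    (msupp (a : {malg K[{fmonom 'I_n}]})).

Definition comm_span (P Q : {pred freealg}) : {pred freealg} :=
  lspan (fun x => `[< exists p q : freealg,
                        [/\ p \in P, q \in Q & x = p * q - q * p] >]).

(* The series starts at index 1; the value L 0 = A is a dummy. *)
Fixpoint L (m : nat) : {pred freealg} :=
  match m with
  | (m'.+1 as k).+1 => comm_span predT (L k)
  | _ => predT
  end.

Lemma L_submod m : submod_closed (L m).
Proof. by case: m => [|[|m]] //; apply: lspan_submod. Qed.

HB.instance Definition _ m :=
  GRing.isSubmodClosed.Build K freealg (L m) (L_submod m).

(* B_m = L_m / L_{m+1} is realized inside A / L_{m+1}; its component of degree d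
   in the induced grading is the image of the degree-d part of L_m. *)
Definition B (m : nat) : {pred quotmod (L m.+1)} := qimage (L m.+1) (L m).

Definition Bdeg (m : nat) (d : 'I_n -> nat) : {pred quotmod (L m.+1)} :=
  qimage (L m.+1) [predI L m & homog d].

End FreeAlgebra.

Arguments L K n m _ : clear implicits.
Arguments B K n m _ : clear implicits.
Arguments Bdeg K n m d _ : clear implicits.

Lemma Bdeg_sub (K : fieldType) n m d : {subset Bdeg K n m d <= B K n m}.
Proof.
by move=> y /asboolP[a /andP[aL _] ->]; apply/asboolP; exists a.
Qed.

(* Main.v *)
(* In multilinear degree everything is read off from signs.  For a set J of
   letters let s_J(w) be the sign of the permutation w restricted to J; these are
   the coefficients of the product of the x_i + xi_i, with commuting x_i and
   anticommuting xi_i, so they vanish on the ideal M3 generated by L_3, and those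
   with |J| even determine a multilinear element modulo M3.

   Since [A, M3] is contained in L_4, an element v = sum_i [x_i, w_i] of L_3
   depends modulo L_4 only on the numbers s_J(x_b w_b), for |J| odd and b in J,
   and the cyclic identities sum_i [x_i, w_i] = 0 only affect the part of them
   that is independent of b.  The differences s_J(x_b w_b) - s_J(x_c w_c) are, up
   to the factor -n, the values at v of the functionals
   w |-> s_J(w) (position of b in w - position of c in w), which vanish on L_4.
   They are coordinates on B_3 and satisfy no further linear relation, so that the
   dimension is the sum of |J| - 1 over the odd subsets J. *)
From HB Require Import structures.
Require Import Defs.
From mathcomp Require Import all_boot all_algebra.
From mathcomp Require Import finmap monalg boolp zify ring.

Set Implicit Arguments.
Unset Strict Implicit.
Unset Printing Implicit Defensive.

Import GRing.Theory.
Local Open Scope ring_scope.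

(** * Word bases of the free algebra *)

(* [wd_ind] says that the words span [A], and [lext] that they are linearly
   independent. *)
Record wordBasis (K : fieldType) (n : nat) (A : algType K) := WordBasis {
  wd : seq 'I_n -> A;
  lext : forall V : lmodType K, (seq 'I_n -> V) -> {linear A -> V};
  wd_nil : wd [::] = 1;
  wd_cat : forall u v, wd (u ++ v) = wd u * wd v;
  lext_wd : forall (V : lmodType K) (f : seq 'I_n -> V) w, lext f (wd w) = f w;
  wd_ind : forall P : A -> Prop,
    P 0 -> (forall k w a, P a -> P (k *: wd w + a)) -> forall a, P a
}.

Arguments wd_ind {K n A} F [P] _ _ a : rename.

Section MonoidAlgebra.
Context (K : fieldType) (M : monomType).
Implicit Types (a b : {malg K[M]}) (k : K) (m : M).

Lemma malg_scalerAr k a b : k *: (a * b) = a * (k *: b).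
Proof.
rewrite -!mul_malgC !mulrA; congr (_ * _).
rewrite !malgM_def fgmulUg fgmulgU; apply: eq_bigr => m _.
by rewrite mul1m mulm1 mulrC.
Qed.

Lemma malgU_scale k m : << k *g m >> = k *: << m >> :> {malg K[M]}.
Proof.
apply/malgP => m'; rewrite mcoeffZ !mcoeffU.
by case: (_ == _); rewrite ?mulr1n ?mulr0n ?mulr1 ?mulr0.
Qed.

Lemma malg_ind (P : {malg K[M]} -> Prop) :
  P 0 -> (forall k m a, P a -> P (k *: << m >> + a)) -> forall a, P a.
Proof.
move=> P0 PD a; rewrite [a]monalgE.
elim: (msupp a : seq _) => [|m s IH]; rewrite ?big_nil ?big_cons // malgU_scale.
exact: PD.
Qed.

Section Extension.
Context (V : lmodType K) (f : M -> V).

Definition mext a : V := \sum_(m <- msupp a) a@_m *: f m.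

Lemma mext_widen (d : {fset M}) a :
  (msupp a `<=` d)%fset -> mext a = \sum_(m <- d) a@_m *: f m.
Proof.
move=> sub; apply: big_fset_incl => // m _ /mcoeff_outdom ->.
by rewrite scale0r.
Qed.

Lemma mext_is_linear : linear mext.
Proof.
move=> k a b; set d := (msupp a `|` msupp b)%fset.
have sa : (msupp a `<=` d)%fset by apply: fsubsetUl.
have sb : (msupp b `<=` d)%fset by apply: fsubsetUr.
rewrite (mext_widen sa) (mext_widen sb) (@mext_widen d).
  rewrite scaler_sumr -big_split /=; apply: eq_bigr => m _.
  by rewrite scalerA -scalerDl mcoeffD mcoeffZ.
apply: fsubset_trans (msuppD_le _ _) _; apply: fsetSU.
exact: msuppZ_le.
Qed.

Lemma mextU m : mext << m >> = f m.
Proof. by rewrite /mext msuppU oner_eq0 big_seq_fset1 mcoeffUU scale1r. Qed.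

End Extension.
End MonoidAlgebra.

Section FreeWords.
Context (K : fieldType) (n : nat).

(* Defs.v only provides the left-algebra structure. *)
HB.instance Definition _ := GRing.Lalgebra_isAlgebra.Build K (freealg K n)
  (@malg_scalerAr K {fmonom 'I_n}).

Definition fwd (w : seq 'I_n) : freealg K n :=
  (<< FMonom w >> : {malg K[{fmonom 'I_n}]}).

Lemma fwd_nil : fwd [::] = 1.
Proof. by rewrite /fwd -fmoneE. Qed.

Lemma fwd_cat u v : fwd (u ++ v) = fwd u * fwd v.
Proof.
rewrite [RHS]malgM_def fgmulUU mulr1 /fwd; congr (<< _ >>).
by apply: val_inj; rewrite /mmul /= fmmulE.
Qed.

Definition flext (V : lmodType K) (f : seq 'I_n -> V) : freealg K n -> V :=
  @mext K {fmonom 'I_n} V (fun m => f m).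

HB.instance Definition _ (V : lmodType K) (f : seq 'I_n -> V) :=
  GRing.isLinear.Build K (freealg K n) V *:%R (flext f) (mext_is_linear _).

Lemma flext_fwd (V : lmodType K) (f : seq 'I_n -> V) w : flext f (fwd w) = f w.
Proof. exact: mextU. Qed.

Lemma fwd_ind (P : freealg K n -> Prop) :
  P 0 -> (forall k w a, P a -> P (k *: fwd w + a)) -> forall a, P a.
Proof. by move=> P0 PD; apply: malg_ind => // k [w] a; apply: PD. Qed.

Definition free_basis : wordBasis n (freealg K n) :=
  WordBasis fwd_nil fwd_cat flext_fwd fwd_ind.

End FreeWords.

(** * The lower central series and the ideal M3 *)

(* Decides equalities of signed sums in an abelian group. *)
Ltac zmod :=
  apply/eqP; rewrite -subr_eq0; apply/eqP;
  rewrite ?mulr2n ?opprD ?opprK ?oppr0 ?addr0 ?add0r -?addrA;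
  rewrite -[LHS]addr0 -?addrA;
  repeat match goal with
  | |- 0 = 0 => reflexivity
  | |- - ?x + (?x + _) = 0 => rewrite (addKr x)
  | |- ?x + (- ?x + _) = 0 => rewrite (addNKr x)
  | |- - ?x + _ = 0 => rewrite [_ + (x + _)]addrCA
  | |- ?x + _ = 0 => rewrite [_ + (- x + _)]addrCA
  end.

Section Alternating.
Context (T : Type) (V : zmodType) (g : T -> T -> T -> T -> T -> V).
Context (g12 : forall a b c d e, g a b c d e = - g b a c d e).
Context (g23 : forall a b c d e, g a b c d e = - g a c b d e).
Context (g45 : forall a b c d e, g a b c d e = - g a b c e d).
Context (g345 : forall a b c d e,
  g a b c d e + g a b d e c + g a b e c d = 0).

(* The last identity expresses that the function on the ten splittings of five
   letters into a triple and a pair is annihilated by the adjacency matrix of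
   the Petersen graph, whose eigenvalues are 3, 1 and -2. *)
Lemma alternating_jacobi0 a b c d e :
  (forall x : V, x *+ 2 = 0 -> x = 0) -> (forall x : V, x *+ 3 = 0 -> x = 0) ->
  g a b c d e = 0.
Proof.
move=> tors2 tors3.
have rot p q r s t : g p q r s t = g q r p s t by rewrite g12 g23 opprK.
have odd2 p q r s t : g p q r s t = g r q p t s.
  by rewrite g12 g23 g12 g45 !opprK.
set n12 := g d e c a b; set n23 := g d e a b c; set n31 := g d e b c a.
set t1 := g a b d e c; set t2 := g a b e c d; set t3 := g b c d e a.
set t4 := g b c e a d; set t5 := g c a d e b; set t6 := g c a e b d.
have n0 : n12 + n23 + n31 = 0 by apply: etrans (g345 d e c a b).
have r53 : t6 + t4 + n12 = 0.
  by rewrite -(g345 e c a b d) (rot e c a) (odd2 e c b) (rot e c d) (rot c d e).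
have r34 : t5 + t3 + n12 = 0.
  rewrite -(g345 c d a b e) (odd2 c d a) (rot a d c) (rot d c a) (rot c d b).
  by rewrite (rot d b c) (rot c d e).
have r51 : t2 + t6 + n23 = 0.
  by rewrite -(g345 e a b c d) (rot e a b) (odd2 e a c) (rot e a d) (rot a d e).
have r14 : t1 + t5 + n23 = 0.
  rewrite -(g345 a d b c e) (odd2 a d b) (rot b d a) (rot d a b) (rot a d c).
  by rewrite (rot d c a) (rot a d e).
have r52 : t4 + t2 + n31 = 0.
  by rewrite -(g345 e b c a d) (rot e b c) (odd2 e b a) (rot e b d) (rot b d e).
have r24 : t3 + t1 + n31 = 0.
  rewrite -(g345 b d c a e) (odd2 b d c) (rot c d b) (rot d b c) (rot b d a).
  by rewrite (rot d a b) (rot b d e).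
have s0 : t1 + t2 + t3 + t4 + t5 + t6 = 0.
  apply: tors2; transitivity (((t6 + t4 + n12) + (t5 + t3 + n12) +
    (t2 + t6 + n23) + (t1 + t5 + n23) + (t4 + t2 + n31) + (t3 + t1 + n31)) -
    (n12 + n23 + n31) *+ 2); first by zmod.
  by rewrite r53 r34 r51 r14 r52 r24 n0 mul0rn !addr0 subr0.
have p1 : g a b c d e + t1 + t2 = 0 by exact: g345.
have p2 : g a b c d e + t3 + t4 = 0 by rewrite rot; exact: g345.
have p3 : g a b c d e + t5 + t6 = 0 by rewrite -rot; exact: g345.
apply: tors3; rewrite mulrS mulr2n.
transitivity ((g a b c d e + t1 + t2) + (g a b c d e + t3 + t4) +
  (g a b c d e + t5 + t6) - (t1 + t2 + t3 + t4 + t5 + t6)); first by zmod.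
by rewrite p1 p2 p3 s0 !addr0 subr0.
Qed.
End Alternating.

Section Quotient.
Context (K : fieldType) (V : lmodType K) (W : submodClosed V).

HB.instance Definition _ := GRing.isLinear.Build K V (quotmod W) *:%R
  (@qproj K V W) (@qproj_is_linear K V W).

Lemma qproj_eq0 v : (qproj W v == 0) = (v \in W).
Proof. by rewrite -(raddf0 (qproj W)) qproj_eq subr0. Qed.

End Quotient.

Section LowerCentralSeries.
Context (K : fieldType) (A : algType K).
Implicit Types (P Q : {pred A}) (a b c d x y z : A).

Definition cm a b : A := a * b - b * a.

Definition cspan P Q : {pred A} :=
  lspan (fun x => `[< exists p q, [/\ p \in P, q \in Q & x = cm p q] >]).

(* Indexed as in Defs.v: the series starts at 1. *)
Fixpoint lcs (m : nat) : {pred A} :=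
  match m with
  | (m'.+1 as k).+1 => cspan predT (lcs k)
  | _ => predT
  end.

Lemma lcs_submod m : submod_closed (lcs m).
Proof. by case: m => [|[|m]] //; apply: lspan_submod. Qed.

HB.instance Definition _ m :=
  GRing.isSubmodClosed.Build K A (lcs m) (lcs_submod m).

Lemma mem_lspan (S : {pred A}) x : x \in S -> x \in lspan S.
Proof.
move=> xS; apply/asboolP; exists 1%N, (fun=> 1), (fun=> x); split=> //.
by rewrite big_ord1 scale1r.
Qed.

Lemma lspan_ind (S : {pred A}) (P : A -> Prop) :
  P 0 -> (forall k x y, P x -> P y -> P (k *: x + y)) ->
  (forall x, x \in S -> P x) -> forall x, x \in lspan S -> P x.
Proof.
move=> P0 PD PS x /asboolP[k [c [s [sS ->]]]].
elim: k c s sS => [|k IH] c s sS; first by rewrite big_ord0.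
by rewrite big_ord_recl; apply: PD; [exact: PS | apply: IH].
Qed.

Lemma mem_lcs m a x : x \in lcs m.+1 -> cm a x \in lcs m.+2.
Proof. by move=> xL; apply: mem_lspan; apply/asboolP; exists a, x. Qed.

Lemma mem_lcsr m a x : x \in lcs m.+1 -> cm x a \in lcs m.+2.
Proof. by move=> xL; rewrite -rpredN opprB mem_lcs. Qed.

Lemma lcs_ind m (P : A -> Prop) :
  P 0 -> (forall k x y, P x -> P y -> P (k *: x + y)) ->
  (forall a x, x \in lcs m.+1 -> P (cm a x)) ->
  forall x, x \in lcs m.+2 -> P x.
Proof.
move=> P0 PD PL; apply: lspan_ind => // _ /asboolP[a [x [_ xL ->]]].
exact: PL.
Qed.

Lemma lcsS m : {subset lcs m.+2 <= lcs m.+1}.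
Proof.
elim: m => // m IH; apply: lcs_ind => [|k x y xL yL|a x /IH].
- exact: rpred0.
- by rewrite rpredD ?rpredZ.
- exact: mem_lcs.
Qed.

Lemma cmC a b : cm a b = - cm b a.
Proof. by rewrite /cm opprB. Qed.

Lemma cmDr a b c : cm a (b + c) = cm a b + cm a c.
Proof. by rewrite /cm mulrDr mulrDl; zmod. Qed.

Lemma cmNr a b : cm a (- b) = - cm a b.
Proof. by rewrite /cm mulrN mulNr; zmod. Qed.

Lemma cmZr k a b : cm a (k *: b) = k *: cm a b.
Proof. by rewrite /cm scalerBr scalerAr scalerAl. Qed.

Lemma cm_jacobi a b c : cm a (cm b c) + cm b (cm c a) + cm c (cm a b) = 0.
Proof. by rewrite /cm !mulrBr !mulrBl !mulrA; zmod. Qed.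

Definition M3 : {pred A} :=
  lspan (fun x => `[< exists a z, z \in lcs 3 /\ x = a * z >]).
HB.instance Definition _ := GRing.SubmodClosed.on M3.

Lemma lcs_M3 z : z \in lcs 3 -> z \in M3.
Proof.
by move=> zL; apply: mem_lspan; apply/asboolP; exists 1, z; rewrite mul1r.
Qed.

Lemma M3_mul a b z : z \in M3 -> a * z * b \in M3.
Proof.
move/asboolP=> [k [c [s [sS ->]]]].
rewrite mulr_sumr mulr_suml; apply: rpred_sum => i _.
rewrite -scalerAr -scalerAl; apply: rpredZ.
have /asboolP[d [x [xL ->]]] := sS i.
have -> : a * (d * x) * b = (a * d * b) * x + (a * d) * cm x b.
  by rewrite /cm !mulrBr !mulrA; zmod.
apply: rpredD; apply: mem_lspan; apply/asboolP.
  by exists (a * d * b), x.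
exists (a * d), (cm x b); split=> //.
by apply/lcsS/mem_lcsr.
Qed.

(* Modulo L_4, the element [a, b [c, u]] with u in L_2 changes sign when a and b
   or b and c are exchanged; for u = [d, e] the Jacobi identity then kills it. *)
Lemma cm_M3 (charK : [pchar K] =i pred0) a z : z \in M3 -> cm a z \in lcs 4.
Proof.
have natK k : k.+1%:R != 0 :> K by rewrite ((pcharf0P K).1 charK).
have step12 p q x : x \in lcs 3 -> cm p (q * x) + cm q (p * x) \in lcs 4.
  move=> xL; have -> : cm p (q * x) + cm q (p * x) =
      cm (p * q) x + cm q (cm p x) by rewrite /cm !mulrBr !mulrBl !mulrA; zmod.
  by apply: rpredD; [exact: mem_lcs | apply/lcsS/mem_lcs/mem_lcs].
have step23 p q r u : u \in lcs 2 ->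
    cm p (q * cm r u) + cm p (r * cm q u) \in lcs 4.
  move=> uL; have -> : cm p (q * cm r u) + cm p (r * cm q u) =
      cm p (cm (q * r) u + cm r (cm q u)).
    by rewrite /cm !(mulrBr, mulrBl, mulrDr, mulrDl) !mulrA; zmod.
  apply: mem_lcs; apply: rpredD; first exact: mem_lcs.
  by apply/lcsS/mem_lcs/mem_lcs.
pose W4 : submodClosed A := lcs 4.
pose g p q r s t := qproj W4 (cm p (q * cm r (cm s t))).
have qD (x y : A) : x + y \in lcs 4 -> qproj W4 x = - qproj W4 y.
  by rewrite -qproj_eq0 raddfD addr_eq0 => /eqP.
have tors k (v : quotmod W4) : v *+ k.+1 = 0 -> v = 0.
  rewrite -scaler_nat => /eqP; rewrite scaler_eq0 (negPf (natK k)) /=.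
  by move/eqP.
have g0 p q r s t : g p q r s t = 0.
  apply: (@alternating_jacobi0 _ _ g) => [*|*|*|a1 a2 a3 a4 a5|v|v].
  - by apply: qD; apply: step12; apply: mem_lcs; apply: (@mem_lcs 0).
  - by apply: qD; apply: step23; apply: (@mem_lcs 0).
  - by rewrite /g -raddfN -cmNr -mulrN -cmNr -cmC.
  - by rewrite /g -!raddfD -!cmDr -!mulrDr cm_jacobi mulr0 /cm mulr0 mul0r subrr raddf0.
  - exact: tors.
  - exact: tors.
have gen p q x : x \in lcs 3 -> cm p (q * x) \in lcs 4.
  have lin (k : K) (y1 y2 : A) :
      cm p (q * (k *: y1 + y2)) = k *: cm p (q * y1) + cm p (q * y2).
    by rewrite mulrDr cmDr -scalerAr cmZr.
  move: x; apply: lcs_ind => [|k y1 y2 L1 L2|r]; last apply: lcs_ind.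
  - by rewrite mulr0 /cm mulr0 mul0r subrr rpred0.
  - by rewrite lin rpredD ?rpredZ.
  - by rewrite /cm !(mulr0, mul0r, subrr) rpred0.
  - by move=> k y1 y2 L1 L2; rewrite cmDr cmZr lin rpredD ?rpredZ.
  - by move=> s t _; rewrite -(qproj_eq0 W4); apply/eqP; exact: (g0 p q r s t).
move: z; apply: lspan_ind => [|k x y|_ /asboolP[q [x [xL ->]]]].
- by rewrite /cm mulr0 mul0r subrr rpred0.
- by move=> xL yL; rewrite cmDr cmZr rpredD ?rpredZ.
- exact: gen.
Qed.
End LowerCentralSeries.
Arguments M3 {K A}.

(** * Signs of restricted words *)

Section Inversions.
Context (n : nat).
Implicit Types (p q u v w : seq 'I_n) (a b : 'I_n).

Fixpoint inversions (w : seq 'I_n) : nat :=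
  if w is a :: w' then (count (fun b : 'I_n => (b < a)%N) w' + inversions w')%N else 0%N.

Lemma odd_inv_swap p a b q : a != b ->
  odd (inversions (p ++ a :: b :: q)) = ~~ odd (inversions (p ++ b :: a :: q)).
Proof.
move=> ab; elim: p => [|c p IH] /=.
  have : (a < b)%N = ~~ (b < a)%N by rewrite -leqNgt ltn_neqAle ab.
  by case: ltnP => _; case: ltnP => _ // _; lia.
rewrite !oddD {}IH !count_cat /=.
set x := count _ p; set y := count _ q.
by rewrite addnCA (addnCA (a < c)%N) /= (addnCA (b < c)%N) addbN.
Qed.

Lemma odd_inv_bswap p u v q : uniq (u ++ v) ->
  odd (inversions (p ++ u ++ v ++ q)) =
  odd (inversions (p ++ v ++ u ++ q)) (+) odd (size u * size v).
Proof.
have step p' a v' q' : a \notin v' ->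
    odd (inversions (p' ++ a :: v' ++ q')) =
    odd (inversions (p' ++ v' ++ a :: q')) (+) odd (size v').
  elim: v' p' => [|b v' IH] p' /=; first by rewrite addbF.
  rewrite inE negb_or => /andP[ab av]; rewrite odd_inv_swap //.
  by rewrite -cat_rcons IH // cat_rcons /= addbN.
elim: u p => [|a u IH] p /=; first by rewrite addbF.
rewrite mem_cat negb_or => /andP[/andP[_ av] uv].
by rewrite -cat_rcons IH // cat_rcons step // oddD -addbA.
Qed.

End Inversions.

Section Signs.
Context (K : fieldType) (n : nat).
Implicit Types (p q u v w : seq 'I_n) (a b : 'I_n) (J : {set 'I_n}).

Definition multilin w := perm_eq w (enum 'I_n).

Definition sgn J w : K :=
  if multilin w then (-1) ^+ inversions (filter (mem J) w) else 0.

Notation cnt J := (count (mem J)).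

Lemma multilin_uniq w : multilin w -> uniq w.
Proof. by move/perm_uniq ->; apply: enum_uniq. Qed.

Lemma multilin_mem w a : multilin w -> a \in w.
Proof. by move/perm_mem ->; rewrite mem_enum. Qed.

Lemma multilin_size w : multilin w -> size w = n.
Proof. by move/perm_size ->; rewrite size_enum_ord. Qed.

Lemma multilin_cnt J w : multilin w -> cnt J w = #|J|.
Proof.
by move/permP => ->; rewrite cardE -size_filter enumT.
Qed.

Lemma multilin_catC u v : multilin (u ++ v) = multilin (v ++ u).
Proof. by rewrite /multilin (permPl (permEl (perm_catC u v))). Qed.

Lemma sgn_swap J p u v q :
  sgn J (p ++ u ++ v ++ q) =
  (-1) ^+ (cnt J u * cnt J v) * sgn J (p ++ v ++ u ++ q).
Proof.
have eqm : multilin (p ++ u ++ v ++ q) = multilin (p ++ v ++ u ++ q).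
  have pe : perm_eq (p ++ u ++ v ++ q) (p ++ v ++ u ++ q).
    by rewrite perm_cat2l !catA perm_cat2r perm_catC.
  by rewrite /multilin (permPl pe).
rewrite /sgn -eqm; case: ifP => [m|_]; last by rewrite mulr0.
rewrite -exprD -!(signr_odd _ (inversions _)) -[RHS]signr_odd oddD.
rewrite !filter_cat odd_inv_bswap ?size_filter.
  by rewrite addbC.
rewrite -filter_cat; apply: filter_uniq.
by move/multilin_uniq: m; rewrite cat_uniq => /and3P[_ _]; rewrite catA cat_uniq => /andP[].
Qed.

Lemma sgn_rot J u v : odd #|J| -> sgn J (u ++ v) = sgn J (v ++ u).
Proof.
move=> Jodd; have := sgn_swap J [::] u v [::]; rewrite /= !cats0 => ->.
have [m|m] := boolP (multilin (u ++ v)); last first.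
  by rewrite /sgn -multilin_catC (negPf m) mulr0.
rewrite -signr_odd oddM.
have := multilin_cnt J m; rewrite count_cat => e.
by move: Jodd; rewrite -e oddD; case: odd; case: odd; rewrite // mul1r.
Qed.

End Signs.
Notation cnt J := (count (mem J)).

Section Functionals.
Context (K : fieldType) (n : nat) (A : algType K) (F : wordBasis n A).
Local Notation W := (wd F).
Implicit Types (p q u v w : seq 'I_n) (i b c : 'I_n) (J : {set 'I_n}).
Implicit Types (a x y z : A).

Lemma cmDl a x y : cm (a + x) y = cm a y + cm x y.
Proof. by rewrite cmC cmDr opprD -!cmC. Qed.

Lemma cmZl k a x : cm (k *: a) x = k *: cm a x.
Proof. by rewrite cmC cmZr -scalerN -cmC. Qed.

Lemma cm0 x : cm x 0 = 0. Proof. by rewrite /cm mulr0 mul0r subrr. Qed.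
Lemma cm0l x : cm 0 x = 0. Proof. by rewrite /cm mulr0 mul0r subrr. Qed.

Section LinearPredicate.
Context (P : A -> Prop).
Context (P0 : P 0) (PD : forall k x y, P x -> P y -> P (k *: x + y)).

Lemma cm_wd_ind x : (forall u, P (cm (W u) x)) -> forall a, P (cm a x).
Proof.
move=> PW a; elim/(wd_ind F): a => [|k w a IH]; first by rewrite cm0l.
by rewrite cmDl cmZl; apply: PD.
Qed.

Lemma cm_wd_indr a : (forall u, P (cm a (W u))) -> forall x, P (cm a x).
Proof.
move=> PW x; elim/(wd_ind F): x => [|k w x IH]; first by rewrite cm0.
by rewrite cmDr cmZr; apply: PD.
Qed.

End LinearPredicate.

Lemma lcs2_wd_ind (P : A -> Prop) :
  P 0 -> (forall k x y, P x -> P y -> P (k *: x + y)) ->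
  (forall u v, P (cm (W u) (W v))) -> forall x, x \in lcs 2 -> P x.
Proof.
move=> P0 PD PW; apply: lcs_ind => // a x _.
by apply: cm_wd_ind => // u; apply: cm_wd_indr.
Qed.

Lemma lcs3_wd_ind (P : A -> Prop) :
  P 0 -> (forall k x y, P x -> P y -> P (k *: x + y)) ->
  (forall u v w, P (cm (W u) (cm (W v) (W w)))) -> forall x, x \in lcs 3 -> P x.
Proof.
move=> P0 PD PW; apply: lcs_ind => // a x xL.
apply: cm_wd_ind => // u; move: x xL; apply: lcs2_wd_ind => //.
- by rewrite cm0.
- by move=> k x y Px Py; rewrite cmDr cmZr; apply: PD.
Qed.

Definition sgnf J : {linear A -> K^o} := lext F (sgn K J : _ -> K^o).

Lemma sgnfW J w : sgnf J (W w) = sgn K J w.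
Proof. exact: lext_wd. Qed.

Definition idxf J b : {linear A -> K^o} :=
  lext F (fun w => sgn K J w * (index b w)%:R : K^o).

Lemma sgnf_cm J p u v q :
  sgnf J (W p * cm (W u) (W v) * W q) =
  (1 - (-1) ^+ (cnt J u * cnt J v)) * sgn K J (p ++ u ++ v ++ q).
Proof.
rewrite /cm mulrBr mulrBl -!wd_cat -!catA raddfB /= !sgnfW.
by rewrite [sgn K J (p ++ v ++ _)]sgn_swap mulrBl mul1r (mulnC (cnt J u)).
Qed.

Lemma sgnf_lcs3 J p q x : x \in lcs 3 -> sgnf J (W p * x * W q) = 0.
Proof.
move: x; apply: lcs3_wd_ind => [|k x y IHx IHy|u v w].
- by rewrite mulr0 mul0r raddf0.
- rewrite mulrDr mulrDl -scalerAr -scalerAl linearD linearZ IHx IHy /=.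
  by rewrite scaler0 addr0.
have -> : W p * cm (W u) (cm (W v) (W w)) * W q =
    W p * cm (W u) (W (v ++ w)) * W q - W p * cm (W u) (W (w ++ v)) * W q.
  by rewrite -mulrBl -mulrBr !wd_cat /cm !(mulrBr, mulrBl, mulrA); zmod.
rewrite raddfB /= !sgnf_cm -!catA.
rewrite !(catA p) (sgn_swap K J (p ++ u)) !count_cat -!catA.
rewrite (addnC (cnt J w)); set s := sgn _ _ _.
rewrite -!(signr_odd _ (_ * _)) !oddM oddD.
by case: (odd (cnt J u)); case: (odd (cnt J v)); case: (odd (cnt J w));
  rewrite /= ?expr0 ?expr1; ring.
Qed.

Lemma sgnf_M3 J a x : x \in M3 -> sgnf J (a * x) = 0.
Proof.
suff gen p y : y \in lcs 3 -> sgnf J (W p * y) = 0.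
  move=> xM; have : sgnf J (1 * a * x) = 0; last by rewrite mul1r.
  move: x xM; apply: lspan_ind => [|k x y IHx IHy|_ /asboolP[c [z [zL ->]]]].
  - by rewrite mulr0 raddf0.
  - by rewrite mulrDr -scalerAr linearD linearZ IHx IHy /= scaler0 addr0.
  rewrite mul1r mulrA; elim/(wd_ind F): (a * c) => [|k w y IH].
    by rewrite mul0r raddf0.
  by rewrite mulrDl -scalerAl linearD linearZ IH /= gen // scaler0 addr0.
by move=> yL; have := sgnf_lcs3 J p [::] yL; rewrite wd_nil mulr1.
Qed.

(* As |J| is odd, rotating a word preserves its sign and only moves b. *)
Lemma idxf_cm J b p x : odd #|J| ->
  idxf J b (cm (W p) x) =
  ((size p)%:R - (b \in p)%:R * n%:R) * sgnf J (W p * x).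
Proof.
move=> Jodd; elim/(wd_ind F): x => [|k v x IH].
  by rewrite cm0 mulr0 !raddf0 mulr0.
rewrite cmDr cmZr mulrDr -scalerAr (linearP (idxf J b)) (linearP (sgnf J)) IH.
rewrite mulrDr; congr (_ + _); rewrite -[in RHS]wd_cat sgnfW /cm.
rewrite -!wd_cat raddfB /= !lext_wd.
rewrite -(sgn_rot K p v Jodd) /= mulrCA; congr (_ * _).
rewrite -mulrBr mulrC; have [m|m] := boolP (multilin (p ++ v)); last first.
  by rewrite /sgn (negPf m) !mulr0.
congr (_ * _); rewrite !index_cat.
have -> : n%:R = (size p)%:R + (size v)%:R :> K.
  by rewrite -natrD -size_cat multilin_size.
have := multilin_mem b m; have := multilin_uniq m.
rewrite cat_uniq mem_cat => /and3P[_ /hasPn nv _].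
have [bp _|bp /= bv] := boolP (b \in p).
  have /negPf -> : b \notin v by apply: contraL bp => /nv.
  by rewrite mul1r !natrD; ring.
by rewrite bv mul0r subr0 !natrD; ring.
Qed.

End Functionals.

(** * Normal forms modulo M3 *)

Lemma perm_swap_adjacent (T : eqType) (s t : seq T) a b :
  perm_eq (s ++ b :: a :: t) (s ++ a :: b :: t).
Proof. by rewrite perm_cat2l; apply/permP => q /=; rewrite addnCA. Qed.

Lemma perm_swap_ind (T : eqType) (P : seq T -> Prop) :
  (forall s a b t, P (s ++ a :: b :: t) -> P (s ++ b :: a :: t)) ->
  forall s t, perm_eq s t -> P s -> P t.
Proof.
move=> swap s t st; suff gen p : P (p ++ s) -> P (p ++ t) by apply: (gen [::]).
have bring a u v q : P (q ++ a :: u ++ v) -> P (q ++ u ++ a :: v).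
  elim: u q => //= b u IH q /swap; rewrite -!(cat_rcons b); exact: IH.
elim: s t p st => [|a s IH] t p st; first by rewrite perm_sym in st; rewrite (perm_nilP st).
have : a \in t by rewrite -(perm_mem st) mem_head.
move: st => /[swap].
case/splitPr => t1 t2 st.
move=> Ps; apply: bring; rewrite -cat_rcons; apply: IH; last by rewrite cat_rcons.
by rewrite -(perm_cons a) (permPl st) -cat1s perm_catCA.
Qed.

Section NormalForm.
Context (K : fieldType) (n : nat) (A : algType K) (F : wordBasis n A).
Local Notation W := (wd F).
Implicit Types (p q u v w C : seq 'I_n) (i j : 'I_n) (J E : {set 'I_n}).
Implicit Types (a b x y z : A).

(* An unpaired last letter gives 0. *)
Fixpoint cpr C : A :=
  match C with
  | i :: j :: C' => cm (W [:: i]) (W [:: j]) * cpr C'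
  | [:: _] => 0
  | [::] => 1
  end.

Lemma sgnf_cpr J u C v : ~~ odd (size C) ->
  sgnf F J (W u * cpr C * W v) =
  (if all (mem J) C then 2 ^+ (size C)./2 * sgn K J (u ++ C ++ v) else 0).
Proof.
have [m] := ubnP (size C); elim: m => // m IH in u C *.
case: C => [|i [|j C]] //= ltm; rewrite ?negbK.
  by move=> _; rewrite mulr1 -wd_cat sgnfW mul1r.
move=> ev; have -> : W u * (cm (W [:: i]) (W [:: j]) * cpr C) * W v =
    W (u ++ [:: i; j]) * cpr C * W v - W (u ++ [:: j; i]) * cpr C * W v.
  rewrite -[[:: i; j]]cat1s -[[:: j; i]]cat1s !wd_cat /cm.
  by rewrite !(mulrBl, mulrBr, mulrA).
have ltC : (size C < m)%N by exact: ltnW ltm.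
rewrite raddfB /= !IH //.
rewrite andbA; case: (all _ C); rewrite ?andbF ?andbT ?subrr // -!catA /=.
have := sgn_swap K J u [:: j] [:: i] (C ++ v); rewrite /= !addn0 => ->.
case: (i \in J); case: (j \in J) => /=; rewrite ?expr0 ?mul1r ?subrr //.
by rewrite exprS; ring.
Qed.

Lemma M3_mull a z : z \in M3 -> a * z \in M3.
Proof. by move=> zM; rewrite -[_ * _]mulr1 M3_mul. Qed.

Lemma M3_mulr b z : z \in M3 -> z * b \in M3.
Proof. by move=> zM; rewrite -[z]mul1r M3_mul. Qed.

Lemma cm2_M3 a b x : cm a (cm b x) \in M3.
Proof. by apply/lcs_M3/mem_lcs/(@mem_lcs _ _ 0). Qed.

Lemma cm2r_M3 a b x : cm (cm b x) a \in M3.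
Proof. by rewrite cmC rpredN cm2_M3. Qed.

Lemma cm_cm_swap_M3 a b x y : cm x a * cm b y + cm x b * cm a y \in M3.
Proof.
have -> : cm x a * cm b y + cm x b * cm a y = cm (cm x (a * b)) y -
    cm (cm x a) y * b - a * cm (cm x b) y + cm (cm x b) (cm a y).
  by rewrite /cm !(mulrBl, mulrBr, mulrA); zmod.
apply: rpredD (cm2_M3 _ _ _); apply: rpredB (M3_mull _ (cm2r_M3 _ _ _)).
exact: rpredB (cm2r_M3 _ _ _) (M3_mulr _ (cm2r_M3 _ _ _)).
Qed.

Lemma cpr_swap_M3 p i j q : cpr (p ++ i :: j :: q) + cpr (p ++ j :: i :: q) \in M3.
Proof.
have [m] := ubnP (size p); elim: m => // m IH in p *.
case: p => [|k [|l p]] /= ltm.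
- by rewrite -mulrDl [cm (W [:: j]) _]cmC subrr mul0r rpred0.
- case: (q) => [|l q'] /=; first by rewrite !mulr0 addr0 rpred0.
  by rewrite !mulrA -mulrDl M3_mulr ?cm_cm_swap_M3.
by rewrite -mulrDr M3_mull ?IH //; apply: ltnW ltm.
Qed.

Context (i0 : 'I_n).

Definition nf E : A := W (enum (~: (i0 |: E))) * cpr (enum E).

Definition evenoff E := (i0 \notin E) && ~~ odd #|E|.

Definition normal x :=
  exists c : {set 'I_n} -> K, x - \sum_(E | evenoff E) c E *: nf E \in M3.

Lemma normalP k x y : normal x -> normal y -> normal (k *: x + y).
Proof.
move=> [c cM] [d dM]; exists (fun E => k * c E + d E).
suff -> : k *: x + y - \sum_(E | evenoff E) (k * c E + d E) *: nf E =
    k *: (x - \sum_(E | evenoff E) c E *: nf E) +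
    (y - \sum_(E | evenoff E) d E *: nf E) by rewrite rpredD ?rpredZ.
under eq_bigr do rewrite scalerDl -scalerA.
by rewrite big_split /= scalerBr scaler_sumr; zmod.
Qed.

Lemma normal_M3 x : x \in M3 -> normal x.
Proof.
by exists (fun=> 0); rewrite big1 ?subr0 // => E _; rewrite scale0r.
Qed.

Lemma normalD x y : normal x -> normal y -> normal (x + y).
Proof. by rewrite -[x in x + _]scale1r; apply: normalP. Qed.

Lemma normalN x : normal x -> normal (- x).
Proof.
by move=> nx; rewrite -scaleN1r -[X in normal X]addr0; apply: normalP => //;
  apply/normal_M3/rpred0.
Qed.

Lemma normal_nf E : evenoff E -> normal (nf E).
Proof.
move=> Eev; exists (fun E' => (E' == E)%:R).
rewrite (bigD1 E) //= eqxx scale1r big1 ?addr0 ?subrr ?rpred0 // => E' /andP[_ /negPf->].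
by rewrite scale0r.
Qed.

Lemma normal_word u C : multilin (i0 :: u ++ C) -> ~~ odd (size C) ->
  normal (W u * cpr C).
Proof.
have [m] := ubnP (size u); elim: m => // m IH in u C * => ltm ml ev.
have uq := multilin_uniq ml; move: (uq) => /=; rewrite cat_uniq mem_cat negb_or.
move=> /andP[/andP[i0u i0C] /and3P[uu /hasPn uC Cu]].
pose E := [set j in C].
have CE : perm_eq (enum E) C.
  by apply: uniq_perm => //; [exact: enum_uniq | move=> j; rewrite mem_enum inE].
have uE : perm_eq (enum (~: (i0 |: E))) u.
  apply: uniq_perm => //; first exact: enum_uniq.
  move=> j; rewrite mem_enum !inE negb_or; have := multilin_mem j ml.
  rewrite inE mem_cat; case: (eqVneq j i0) => [->|_] /=; first by rewrite (negPf i0u).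
  by have [/uC/negPf -> //|_] := boolP (j \in C); rewrite orbF => ->.
have nfC : normal (W (enum (~: (i0 |: E))) * cpr C).
  apply: (perm_swap_ind
    (P := fun s => normal (W (enum (~: (i0 |: E))) * cpr s)) _ CE); last first.
    by apply: normal_nf; rewrite /evenoff inE i0C cardsE (card_uniqP Cu).
  move=> s a b t nx.
  rewrite -[X in normal X](addrK (W (enum (~: (i0 |: E))) * cpr (s ++ a :: b :: t))).
  apply: normalD (normalN nx); apply: normal_M3.
  by rewrite -mulrDr M3_mull // cpr_swap_M3.
suff [] : perm_eq u u /\ normal (W u * cpr C) by [].
apply: (perm_swap_ind (P := fun s => perm_eq s u /\ normal (W s * cpr C)) _ uE); last by [].
move=> s a b t [su nx]; split.
  by rewrite -(permPr su) perm_swap_adjacent.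
have -> : W (s ++ b :: a :: t) * cpr C = W (s ++ a :: b :: t) * cpr C +
  - (W (s ++ t) * cpr [:: a, b & C]) +
  W s * cm (W t) (cm (W [:: a]) (W [:: b])) * cpr C.
  rewrite /= -[a :: b :: t]cat1s -[b :: t]cat1s -[b :: a :: t]cat1s -[a :: t]cat1s.
  by rewrite !wd_cat /cm !(mulrBl, mulrBr, mulrA); zmod.
have nst : normal (W (s ++ t) * cpr [:: a, b & C]).
  apply: IH => /=; rewrite ?negbK //.
    by have := perm_size su; rewrite !size_cat /=; lia.
  have pst : perm_eq ((s ++ t) ++ [:: a, b & C]) (u ++ C).
    rewrite -(permPr (perm_cat su (perm_refl C))) -!catA perm_cat2l.
    by rewrite (perm_catCA t [:: a; b] C).
  by rewrite /multilin -(permPr ml) perm_cons.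
apply: normalD; first by apply: normalD nx _; apply: normalN.
by apply: normal_M3; rewrite M3_mul ?cm2_M3.
Qed.

Definition prj : {linear A -> A} :=
  lext F (fun w => if multilin (i0 :: w) then W w else 0).

Lemma normal_prj x : normal (prj x).
Proof.
elim/(wd_ind F): x => [|k w x IH]; first by rewrite raddf0; apply/normal_M3/rpred0.
rewrite linearP; apply: normalP => //; rewrite lext_wd.
case: ifP => ml; last by apply/normal_M3/rpred0.
by have := @normal_word w [::]; rewrite cats0 mulr1; apply.
Qed.

(* The matrix of the s_(i0 |: J) on the [nf E] is triangular for inclusion, with
   diagonal entries plus or minus powers of 2. *)
Lemma prj_M3 (charK : [pchar K] =i pred0) x :
  (forall J, odd #|J| -> i0 \in J -> sgnf F J (W [:: i0] * prj x) = 0) ->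
  prj x \in M3.
Proof.
move=> x0; have [c cM] := normal_prj x.
set y := \sum_(E | _) _ in cM.
have y0 J : odd #|J| -> i0 \in J -> sgnf F J (W [:: i0] * y) = 0.
  move=> Jo Ji; have := sgnf_M3 F J (W [:: i0]) cM.
  by rewrite mulrBr raddfB /= x0 // sub0r => /eqP; rewrite oppr_eq0 => /eqP.
suff c0 E : evenoff E -> c E = 0.
  have y00 : y = 0 by rewrite /y big1 // => E /c0 ->; rewrite scale0r.
  by rewrite y00 subr0 in cM.
have nfE J E' : evenoff E' -> sgnf F J (W [:: i0] * nf E') =
    if E' \subset J then 2 ^+ #|E'|./2 *
       sgn K J (i0 :: enum (~: (i0 |: E')) ++ enum E') else 0.
  move=> /andP[_ ev]; rewrite mulrA -wd_cat -[_ * cpr _]mulr1 -(wd_nil F).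
  rewrite sgnf_cpr -?cardE // cats0.
  suff -> : all (mem J) (enum E') = (E' \subset J) by [].
  by apply/allP/subsetP => sub j;
    [move=> jE; apply: sub; rewrite mem_enum| rewrite mem_enum => /sub].
have [m] := ubnP #|E|; elim: m => // m IH in E * => ltm Eev.
have [i0E ev] := andP Eev.
have Jo : odd #|i0 |: E| by rewrite cardsU1 i0E oddD (negPf ev).
have := y0 _ Jo (setU11 _ _); rewrite /y mulr_sumr raddf_sum (bigD1 E) //= big1 ?addr0.
  rewrite -scalerAr linearZ /= nfE // subsetUr => /eqP.
  rewrite mulf_eq0 => /orP[/eqP//|]; rewrite mulf_eq0 expf_eq0.
  rewrite ((pcharf0P K).1 charK) andbF /= /sgn.
  have -> : multilin (i0 :: enum (~: (i0 |: E)) ++ enum E).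
    apply: uniq_perm; rewrite ?enum_uniq //=.
      rewrite mem_cat !mem_enum !inE eqxx /= (negPf i0E) cat_uniq !enum_uniq andbT /=.
      by apply/hasPn => j; rewrite !mem_enum !inE => ->; rewrite orbT.
    move=> j; rewrite inE mem_cat !mem_enum !inE.
    by case: (j == i0); case: (j \in E).
  by rewrite signr_eq0.
move=> E' /andP[E'ev neq]; rewrite -scalerAr linearZ /= nfE //.
case: ifP => [sub|]; last by rewrite scaler0.
rewrite IH ?scale0r //; rewrite ltnS in ltm; apply: leq_trans ltm.
apply: proper_card; rewrite properEneq neq; apply/subsetP => j jE'.
have := subsetP sub j jE'; rewrite !inE => /orP[/eqP ji|//].
by case/andP: E'ev; rewrite -ji jE'.
Qed.

End NormalForm.

(** * Separation of L_3 modulo L_4 *)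

Section SignIdentities.
Context (K : fieldType) (n : nat).
Implicit Types (p q u v w z : seq 'I_n) (i j k : 'I_n) (J : {set 'I_n}).

Definition rank_sign J k : K := (-1) ^+ #|[set j in J | (j < k)%N]|.

Lemma sgn_setD1 J k z : k \in J -> multilin z ->
  rank_sign J k * sgn K (J :\ k) z = (-1) ^+ cnt J (take (index k z) z) * sgn K J z.
Proof.
move=> kJ ml; rewrite /sgn ml; have kz := multilin_mem k ml.
have uz := multilin_uniq ml.
case/path.splitPr: kz ml uz => p q ml uz.
have [kp kq] : k \notin p /\ k \notin q.
  by move: uz; rewrite cat_uniq /= negb_or => /and3P[_ /andP[-> _] /andP[-> _]].
have fD s : k \notin s -> filter (mem (J :\ k)) s = filter (mem J) s.
  move=> ks; apply: eq_in_filter => j js; rewrite /= !inE.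
  by case: eqVneq js ks => [-> ->|].
have -> : rank_sign J k = (-1) ^+ count (fun b : 'I_n => b < k)%N (filter (mem J) (p ++ q)).
  rewrite /rank_sign -(multilin_cnt _ ml); congr (_ ^+ _).
  rewrite count_filter !count_cat /= inE ltnn andbF add0n -!count_cat.
  by apply: eq_count => j; rewrite !inE andbC.
rewrite index_cat (negPf kp) /= eqxx addn0 take_size_cat // !filter_cat /= kJ.
rewrite !inE eqxx /= !fD // -!exprD -[LHS]signr_odd -[RHS]signr_odd.
congr (_ ^+ nat_of_bool _).
have := @odd_inv_bswap n [::] (filter (mem J) p) [:: k] (filter (mem J) q).
rewrite /= muln1 size_filter [odd (cnt J p + _)]oddD => ->.
  by rewrite addbC -addbA addbb addbF.
rewrite cats1 rcons_uniq filter_uniq ?mem_filter ?(negPf kp) ?andbF //.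
by move: uz; rewrite cat_uniq => /and3P[].
Qed.

Lemma alternating_count J z : uniq z ->
  \sum_(k <- z | k \in J) (-1) ^+ cnt J (take (index k z) z) = (odd (cnt J z))%:R :> K.
Proof.
elim: z => [|a z IH] /= => [_|/andP[az /IH {}IH]]; first by rewrite big_nil.
have sub : \sum_(k <- z | k \in J)
    (-1) ^+ cnt J (take (index k (a :: z)) (a :: z)) =
    (-1) ^+ (a \in J) * \sum_(k <- z | k \in J) (-1) ^+ cnt J (take (index k z) z) :> K.
  rewrite mulr_sumr big_seq_cond [RHS]big_seq_cond.
  apply: eq_bigr => k /andP[kz _] /=; case: eqVneq kz => [<- kz|_ _ /=].
    by rewrite kz in az.
  by rewrite exprD.
rewrite big_cons sub IH /= eqxx /= oddD.
by case: (a \in J); case: odd => /=; rewrite ?expr0 ?expr1; ring.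
Qed.

Lemma sgn_even_expand J i w : i \in J -> ~~ odd #|J| ->
  sgn K J (i :: w) = - \sum_(k in J :\ i) rank_sign J k * sgn K (J :\ k) (i :: w).
Proof.
move=> iJ Jev; have [ml|ml] := boolP (multilin (i :: w)); last first.
  rewrite big1 ?oppr0 => [|k _]; first by rewrite /sgn (negPf ml).
  by rewrite /sgn (negPf ml) mulr0.
have := alternating_count J (multilin_uniq ml).
rewrite (multilin_cnt _ ml) (negPf Jev) => e.
have {e} : \sum_(k in J) (-1) ^+ cnt J (take (index k (i :: w)) (i :: w)) = 0 :> K.
  by rewrite -[RHS]e (perm_big _ ml) /= big_enum_cond.
rewrite (bigD1 i iJ) /= eqxx /= expr0 => e.
rewrite (eq_bigl (fun k => (k \in J) && (k != i))) => [|k]; last by rewrite !inE andbC.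
under eq_bigr => k /andP[kJ _] do rewrite sgn_setD1 //.
by rewrite -mulr_suml -mulNr; have /eqP := e; rewrite addr_eq0 => /eqP <-; rewrite mul1r.
Qed.

End SignIdentities.

Section UpperBound.
Context (K : fieldType) (charK : [pchar K] =i pred0).
Context (n : nat) (A : algType K) (F : wordBasis n A).
Local Notation W := (wd F).
Implicit Types (p q u v w z : seq 'I_n) (i j k b c : 'I_n) (J : {set 'I_n}).
Implicit Types (a x y t : A).

Definition mlproj : {linear A -> A} :=
  lext F (fun w => if multilin w then W w else 0).

Lemma lcs2_letters x : x \in lcs 2 ->
  exists a : 'I_n -> A, x = \sum_i cm (W [:: i]) (a i).
Proof.
move: x; apply: (lcs2_wd_ind (F := F)) => [|k _ _ [a ->] [b ->]|u v].
- by exists (fun=> 0); rewrite big1 // => i _; rewrite cm0.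
- exists (fun i => k *: a i + b i); rewrite scaler_sumr -big_split /=.
  by apply: eq_bigr => i _; rewrite cmDr cmZr.
move: (W v) => {v} y; elim: u y => [|i u IH] y.
  exists (fun=> 0); rewrite big1 => [|i _]; last by rewrite cm0.
  by rewrite wd_nil /cm mulr1 mul1r subrr.
have [a ua] := IH (y * W [:: i]).
exists (fun j => (if j == i then W u * y else 0) + a j).
under eq_bigr do rewrite cmDr; rewrite big_split /= -ua (bigD1 i) //= eqxx.
rewrite big1 ?addr0 => [|j /negPf ->]; last by rewrite cm0.
by rewrite -cat1s wd_cat /cm !mulrA; zmod.
Qed.

Lemma mlproj_cm_letter i a : mlproj (cm (W [:: i]) a) = cm (W [:: i]) (prj F i a).
Proof.
elim/(wd_ind F): a => [|k w a IH]; first by rewrite !(cm0, raddf0).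
rewrite cmDr cmZr (linearP mlproj) IH (linearP (prj F i)) cmDr cmZr.
congr (_ *: _ + _); rewrite /cm raddfB /= -!wd_cat !lext_wd multilin_catC.
by rewrite [multilin (w ++ _)]multilin_catC; case: ifP; rewrite ?wd_cat ?mulr0 ?mul0r.
Qed.

Lemma idxf_cm_letter J b i y : odd #|J| ->
  idxf F J b (cm (W [:: i]) y) =
  (1 - (b == i)%:R * n%:R) * sgnf F J (W [:: i] * y).
Proof. by move=> Jo; rewrite idxf_cm // inE. Qed.

Lemma sgnf_cm_letter J i y : ~~ odd #|J| ->
  sgnf F J (cm (W [:: i]) y) = (i \in J)%:R * 2 * sgnf F J (W [:: i] * y).
Proof.
have [c cE] : exists c : K, c = (i \in J)%:R * 2 by eexists.
move=> Jev; rewrite -cE; elim/(wd_ind F): y => [|k w y IH].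
  by rewrite cm0 mulr0 !raddf0 mulr0.
rewrite cmDr cmZr mulrDr -scalerAr !(linearP (sgnf F J)) IH mulrDr.
congr (_ + _); rewrite /cm raddfB /= -!wd_cat !sgnfW cE {c cE IH}.
have [ml|ml] := boolP (multilin (i :: w)); last first.
  have mlr : multilin (w ++ [:: i]) = false by rewrite multilin_catC; exact: negbTE.
  by rewrite /sgn /= mlr (negPf ml) subrr !scaler0 mulr0.
have := sgn_swap K J [::] w [:: i] [::]; rewrite /= !cats0 => ->.
have := multilin_cnt J ml; rewrite /= addn0 => e.
move: Jev; rewrite -e oddD -signr_odd oddM oddb.
case: (i \in J) => /=; case: odd => //= _; rewrite /GRing.scale /= ?expr1 ?expr0; ring.
Qed.

Lemma sgnf_even_expand J i y : i \in J -> ~~ odd #|J| ->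
  sgnf F J (W [:: i] * y) =
  - \sum_(k in J :\ i) rank_sign K J k * sgnf F (J :\ k) (W [:: i] * y).
Proof.
move=> iJ Jev; elim/(wd_ind F): y => [|l w y IH].
  by rewrite mulr0 raddf0 big1 ?oppr0 // => k _; rewrite raddf0 mulr0.
rewrite mulrDr -scalerAr -wd_cat (linearP (sgnf F J)) IH sgnfW sgn_even_expand //.
under [in RHS]eq_bigr => k _.
  rewrite (linearP (sgnf F (J :\ k))) sgnfW mulrDr -[_ *: _]/(l * _) mulrCA.
over.
by rewrite big_split /= -mulr_sumr opprD -[_ *: _]/(l * _) mulrN.
Qed.

(* Deletes i from the rotation of the word that starts at i. *)
Definition unrot i : {linear A -> A} :=
  lext F (fun z => if multilin z then W (behead (rot (index i z) z)) else 0).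

Lemma rot_indexE i z : multilin z ->
  rot (index i z) z = i :: behead (rot (index i z) z).
Proof.
move=> /(multilin_mem i) iz; rewrite /rot (drop_nth i) ?index_mem //=.
by rewrite nth_index.
Qed.

(* The cyclic identity: the i-th summand is the difference between the rotations
   of the word starting at i and just after i. *)
Lemma sum_cm_unrot t : \sum_i cm (W [:: i]) (unrot i t) = 0.
Proof.
elim/(wd_ind F): t => [|k z t IH].
  by rewrite big1 // => i _; rewrite raddf0 cm0.
under eq_bigr do rewrite linearP cmDr cmZr.
rewrite big_split /= IH addr0 -scaler_sumr (_ : \sum_i _ = 0) ?scaler0 //.
under eq_bigr do rewrite lext_wd.
have [ml|_] := boolP (multilin z); last by rewrite big1 // => i _; rewrite cm0.
transitivity (\sum_i (W (rot (index i z) z) - W (rot (index i z).+1 z))).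
  apply: eq_bigr => i _; rewrite /cm -!wd_cat cats1 -rot1_cons.
  by rewrite cat1s -rot_indexE // -rotS // index_mem multilin_mem.
have [z0|[i0]] : z = [::] \/ inhabited 'I_n by case: (z) => [|i0 ?]; [left|right].
  by rewrite big1 // => i _; have := multilin_mem i ml; rewrite z0.
rewrite -big_enum -(perm_big _ ml) (big_nth i0) big_nat_cond.
under eq_bigr => m /andP[/andP[_ mz] _] do rewrite index_uniq ?(multilin_uniq ml) //.
rewrite -big_nat_cond (@telescope_sumr_eq _ _ _ (fun m => - W (rot m z))) => [|//|m _].
  by rewrite rot_size rot0 subrr.
by rewrite opprK addrC.
Qed.

Lemma prj_unrot i t : prj F i (unrot i t) = unrot i t.
Proof.
elim/(wd_ind F): t => [|k z t IH]; first by rewrite !raddf0.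
rewrite (linearP (unrot i)) (linearP (prj F i)) IH lext_wd.
case: ifP => ml; last by rewrite raddf0.
rewrite lext_wd -rot_indexE // ifT // /multilin.
by rewrite (permPl (permEl (perm_rot _ _))).
Qed.

Lemma unrot_letter i a : unrot i (W [:: i] * prj F i a) = prj F i a.
Proof.
elim/(wd_ind F): a => [|k w a IH]; first by rewrite raddf0 mulr0 raddf0.
rewrite (linearP (prj F i)) mulrDr -scalerAr (linearP (unrot i)) IH lext_wd.
congr (_ *: _ + _); case: ifP => ml; last by rewrite mulr0 raddf0.
by rewrite -wd_cat lext_wd ml /= eqxx rot0.
Qed.

Lemma lcs4_of_idxf (i0 : 'I_n) x : x \in lcs 3 -> mlproj x = x ->
  (forall J b c, odd #|J| -> b \in J -> c \in J -> idxf F J b x = idxf F J c x) ->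
  x \in lcs 4.
Proof.
move=> xL3 xml xidx.
have nat0 m : (m%:R == 0 :> K) = (m == 0)%N by exact: ((pcharf0P K).1 charK).
have n0 : n%:R != 0 :> K by rewrite nat0 -lt0n (leq_ltn_trans _ (ltn_ord i0)).
have [a xa] := lcs2_letters (lcsS xL3).
pose y i := prj F i (a i) - unrot i (W [:: i0] * prj F i0 (a i0)).
have xy : x = \sum_i cm (W [:: i]) (y i).
  under eq_bigr do rewrite cmDr cmNr.
  rewrite sumrB sum_cm_unrot subr0 -xml xa raddf_sum.
  by apply: eq_bigr => i _; rewrite /= mlproj_cm_letter.
have yprj i : prj F i (y i) = y i.
  rewrite raddfB /= prj_unrot; congr (_ - _).
  elim/(wd_ind F): (a i) => [|k w z IH]; first by rewrite !raddf0.
  rewrite (linearP (prj F i)) (linearP (prj F i)) IH lext_wd.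
  by case: ifP => ml; rewrite ?raddf0 // lext_wd ml.
have y0 : y i0 = 0 by rewrite /y unrot_letter subrr.
(* [chi] is the coefficient function of an odd form; sgnf (i0 |: J) x = 0 says that
   it is closed, and y i0 = 0 that it has no component involving i0. *)
pose chi J b := sgnf F J (W [:: b] * y b).
have chi_const J b c : odd #|J| -> b \in J -> c \in J -> chi J b = chi J c.
  have idxE d : odd #|J| -> idxf F J d x =
      \sum_i sgnf F J (W [:: i] * y i) - n%:R * chi J d.
    move=> Jo; rewrite xy raddf_sum (bigD1 d) //= [in RHS](bigD1 d) //=.
    rewrite idxf_cm_letter // eqxx mul1r mulrBl mul1r addrAC; congr (_ + _ - _).
    apply: eq_bigr => i /negPf id_; rewrite idxf_cm_letter // eq_sym id_.
    by rewrite mul0r subr0 mul1r.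
  move=> Jo bJ cJ; have := xidx J b c Jo bJ cJ; rewrite !idxE //.
  by move/addrI/oppr_inj/(mulfI n0).
suff chi0 : forall J b, odd #|J| -> b \in J -> chi J b = 0.
  rewrite xy; apply: rpred_sum => i _; apply: cm_M3 => //.
  by rewrite -yprj; apply: prj_M3 => // J Jo iJ; rewrite yprj; apply: chi0.
move=> J b.
have chi0 (E : {set 'I_n}) c : odd #|E| -> i0 \in E -> c \in E -> chi E c = 0.
  by move=> Jo i0J bJ; rewrite (chi_const _ _ i0) // /chi y0 mulr0 raddf0.
move=> Jo bJ; have [i0J|i0J] := boolP (i0 \in J); first exact: chi0.
set J' := i0 |: J.
have J'ev : ~~ odd #|J'| by rewrite cardsU1 i0J oddD Jo.
have sxy i : sgnf F J' (cm (W [:: i]) (y i)) =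
    if i \in J then - 2 * rank_sign K J' i0 * chi J b else 0.
  rewrite sgnf_cm_letter //; case: (eqVneq i i0) => [->|ii0].
    by rewrite y0 (negPf i0J) mulr0 raddf0 mulr0.
  rewrite !inE (negPf ii0) /=; case: ifP => iJ; last by rewrite !mul0r.
  have iJ' : i \in J' by rewrite !inE iJ orbT.
  rewrite sgnf_even_expand // (bigD1 i0) /=; last by rewrite !inE eqxx eq_sym ii0.
  rewrite big1 ?addr0 => [|k /andP[]]; last first.
    rewrite !inE => /andP[ki kJ'] ki0.
    have kJ : k \in J by rewrite (negPf ki0) in kJ'.
    rewrite [sgnf _ _ _](chi0 _ i) ?mulr0 //.
    - have kJ2 : k \in J' by rewrite !inE kJ orbT.
      by move: J'ev; rewrite (cardsD1 k) kJ2 /= negbK.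
    - by rewrite !inE eqxx eq_sym ki0.
    - by rewrite !inE eq_sym ki iJ orbT.
  have -> : J' :\ i0 = J by rewrite setU1K.
  by rewrite -[sgnf _ _ _]/(chi J i) (chi_const J i b) // mul1r; ring.
have := sgnf_lcs3 F J' [::] [::] xL3; rewrite wd_nil mul1r mulr1 xy raddf_sum /=.
under eq_bigr do rewrite sxy.
rewrite -big_mkcond sumr_const => e.
have {e}/eqP : - 2 * rank_sign K J' i0 * (chi J b : K) * #|J|%:R = 0 :> K.
  by rewrite mulr_natr.
rewrite !mulf_eq0 oppr_eq0 !nat0 signr_eq0 /= => /orP[/eqP //|].
by rewrite cards_eq0 => /eqP J0; rewrite J0 inE in bJ.
Qed.

End UpperBound.

(** * Independence of the coordinates *)

Section LowerBound.
Context (K : fieldType) (charK : [pchar K] =i pred0).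
Context (n : nat) (A : algType K) (F : wordBasis n A).
Local Notation W := (wd F).
Implicit Types (p q u v w z : seq 'I_n) (i j k a b : 'I_n) (J E : {set 'I_n}).
Implicit Types (x y : A).

Lemma filter_enum_set J E : filter (mem J) (enum E) = enum (J :&: E).
Proof.
rewrite /enum_mem -filter_predI.
by apply: eq_filter => j; rewrite /= !inE.
Qed.

Lemma eq_sgn J u v : multilin u -> multilin v ->
  filter (mem J) u = filter (mem J) v -> sgn K J u = sgn K J v.
Proof. by rewrite /sgn => -> -> ->. Qed.

Lemma cnt_sub J C : all (mem J) C -> cnt J C = size C.
Proof. by rewrite all_count => /eqP. Qed.

Lemma sgnf_cm_cpr J p q k C : ~~ odd (size C) ->
  sgnf F J (W p * cm (W q) (W [:: k] * cpr F C)) =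
  if all (mem J) C then
    2 ^+ (size C)./2 * (1 - (-1) ^+ (cnt J q * cnt J (k :: C))) *
      sgn K J (p ++ q ++ k :: C)
  else 0.
Proof.
move=> ev.
have -> : W p * cm (W q) (W [:: k] * cpr F C) =
    W (p ++ q ++ [:: k]) * cpr F C * W [::] - W (p ++ [:: k]) * cpr F C * W q.
  by rewrite !wd_cat wd_nil mulr1 /cm !(mulrBl, mulrBr, mulrA).
rewrite raddfB /= !sgnf_cpr // cats0 -!catA; case: ifP => _; last by rewrite subrr.
have := sgn_swap K J p (k :: C) q [::]; rewrite !cats0 /= => ->.
by rewrite mulnC mulrBr mulr1 mulrBl mulrA.
Qed.

Context (c : {set 'I_n} -> 'I_n -> K).
Context (c_sum0 : forall J, odd #|J| -> \sum_(b in J) c J b = 0).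
Context (c_lcs3 : forall x, x \in lcs 3 ->
  \sum_(J : {set 'I_n} | odd #|J|) \sum_(b in J) c J b * idxf F J b x = 0).

Lemma c_cm p x : x \in lcs 2 ->
  \sum_(J : {set 'I_n} | odd #|J|) sgnf F J (W p * x) * \sum_(b in J | b \in p) c J b = 0.
Proof.
move=> xL2.
have [n0|n0] := posnP n.
  by rewrite big1 // => J _; rewrite big1 ?mulr0 // => b; have := ltn_ord b; lia.
have := c_lcs3 (mem_lcs (W p) xL2).
have inner (J : {set 'I_n}) : odd #|J| -> \sum_(b in J) c J b * idxf F J b (cm (W p) x) =
    - n%:R * (sgnf F J (W p * x) * \sum_(b in J | b \in p) c J b).
  move=> Jo; under eq_bigr do rewrite idxf_cm //.
  rewrite (eq_bigr (fun b => (size p)%:R * sgnf F J (W p * x) * c J b +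
    - n%:R * (sgnf F J (W p * x) * (c J b * (b \in p)%:R)))) => [|b _]; last by ring.
  rewrite big_split /= -mulr_sumr c_sum0 // mulr0 add0r -!mulr_sumr; congr (_ * (_ * _)).
  rewrite big_mkcondr /=; apply: eq_bigr => b _.
  by case: ifP; rewrite ?mulr1 ?mulr0.
under eq_bigr do rewrite inner //.
rewrite -mulr_sumr => /eqP; rewrite mulf_eq0 oppr_eq0.
by rewrite ((pcharf0P K).1 charK) -[n == 0%N]negbK -lt0n n0 /= => /eqP.
Qed.

Definition rest E p := enum (~: (E :|: [set j in p])).

Lemma multilin_rest E p C : uniq p -> {in p, forall j, j \notin E} ->
  perm_eq C (enum E) -> multilin (p ++ rest E p ++ C).
Proof.
move=> up pE CE; apply: uniq_perm; rewrite ?enum_uniq //.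
  rewrite !cat_uniq up enum_uniq (perm_uniq CE) enum_uniq andbT /=.
  apply/andP; split; apply/hasPn => j.
    rewrite mem_cat (perm_mem CE) !mem_enum !inE negb_or.
    by case/orP => [/andP[]//|jE]; apply: contraL jE => /pE.
  by rewrite (perm_mem CE) !mem_enum !inE negb_or => ->.
move=> j; rewrite !mem_cat (perm_mem CE) !mem_enum !inE.
by case: (j \in p); case: (j \in E).
Qed.

Lemma rest_filter J E p b : b \notin J ->
  filter (mem J) (rest E (rcons p b)) = filter (mem J) (rest E p).
Proof.
move=> bJ; rewrite !filter_enum_set; apply: eq_enum => j.
rewrite !inE mem_rcons inE; case: (eqVneq j b) => [->|] //=.
by rewrite (negPf bJ).
Qed.

(* Downward induction on |J|.  With E = J \ {a, b}, the three elements
   [x_p, [x_q, x_k [x_i, x_j] ...]] of L_3, where k, i, j, ... enumerate E, p is a,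
   b or ab, and q lists the other letters, are combined so that only the term of
   J and terms of larger sets survive. *)
Lemma idxf_independent J b : odd #|J| -> b \in J -> c J b = 0.
Proof.
have [m] := ubnP (n - #|J|); elim: m => // m IH in J b * => ltm Jo bJ.
suff c_const a : a \in J -> c J a = c J b.
  have /eqP := c_sum0 Jo; rewrite (eq_bigr (fun=> c J b)) //.
  rewrite sumr_const -mulr_natr mulf_eq0 ((pcharf0P K).1 charK) => /orP[/eqP//|].
  by rewrite cards_eq0 => /eqP J0; rewrite J0 inE in bJ.
move=> aJ; have [-> //|ab] := eqVneq a b.
have bigger J' a' : odd #|J'| -> J \proper J' -> a' \in J' -> c J' a' = 0.
  move=> J'o JJ' a'J'; apply: IH => //.
  have lt1 : (#|J| < #|J'|)%N by exact: proper_card.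
  have lt2 : (#|J'| <= n)%N by rewrite -[leqRHS]card_ord max_card.
  by move: ltm lt1 lt2; clear; lia.
pose E := J :\ a :\ b.
have bJa : b \in J :\ a by rewrite !inE eq_sym ab.
have cardE2 : #|J| = #|E|.+2 by rewrite (cardsD1 a) aJ (cardsD1 b) bJa.
case eE : (enum E) => [|k C].
  by move: Jo; rewrite cardE2 cardE eE.
have sC : #|E| = (size C).+1 by rewrite cardE eE.
have evC : ~~ odd (size C) by move: Jo; rewrite cardE2 sC /= !negbK.
have memE j : (j \in k :: C) = [&& j != b, j != a & j \in J].
  by rewrite -eE mem_enum !inE.
pose x p := cm (W (rest E p)) (W [:: k] * cpr F C).
have xL2 p : x p \in lcs 2 by apply: (@mem_lcs _ _ 0).
pose T p J' := sgnf F J' (W p * x p) * \sum_(b' in J' | b' \in p) c J' b'.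
have T0 p J' : {in p, forall j, j \notin J'} -> T p J' = 0.
  move=> pJ'; rewrite /T big1 ?mulr0 // => j /andP[jJ' /pJ'].
  by rewrite jJ'.
have ml p : uniq p -> {subset p <= [:: a; b]} -> multilin (p ++ rest E p ++ k :: C).
  move=> up pab; apply: multilin_rest => //; last by rewrite eE.
  by move=> j /pab; rewrite !inE => /orP[] /eqP ->; rewrite eqxx ?andbF.
have sab : \sum_(J' : {set 'I_n} | odd #|J'|)
    (T [:: a] J' + T [:: b] J' - T [:: a; b] J') = 0.
  by rewrite sumrB big_split /= !c_cm // addr0 subrr.
have sum2 p J' d : uniq p -> d \in J' -> d \in p ->
    {in p, forall j, j != d -> j \notin J'} ->
    \sum_(b' in J' | b' \in p) c J' b' = c J' d.
  move=> up dJ dp oth; rewrite (bigD1 d) ?dJ //= big1 ?addr0 // => j /andP[/andP[jJ jp] jd].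
  by have := oth j jp jd; rewrite jJ.
have one J' d e : d != e -> d \in [:: a; b] -> e \in [:: a; b] ->
    d \in J' -> e \notin J' -> T [:: d] J' = T [:: a; b] J' /\ T [:: e] J' = 0.
  move=> de dab eab dJ eJ; split; last by apply: T0 => j; rewrite inE => /eqP ->.
  have abE j : (j \in [:: a; b]) = (j == d) || (j == e).
    move: dab eab; rewrite !inE => /orP[]/eqP ed /orP[]/eqP ee; subst d e;
      rewrite ?eqxx // in de *; exact: orbC.
  have fd : filter (mem J') [:: d] = filter (mem J') [:: a; b].
    move: dab eab dJ eJ; rewrite !inE => /orP[]/eqP ed /orP[]/eqP ee; subst d e;
      rewrite ?eqxx // in de *; by move=> dJ /negPf eJ /=; rewrite dJ eJ.
  have fr : filter (mem J') (rest E [:: d]) = filter (mem J') (rest E [:: a; b]).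
    rewrite -(rest_filter E [:: d] eJ) !filter_enum_set; apply: eq_enum => j.
    by have := abE j; rewrite !inE => ->.
  rewrite /T (sum2 [:: d] _ d) ?mem_head // => [|j]; last first.
    by rewrite inE => /eqP ->; rewrite eqxx.
  have uab : uniq [:: a; b] by rewrite /= inE ab.
  rewrite (sum2 [:: a; b] _ d) //; last first.
    by move=> j; rewrite abE => /orP[]/eqP -> //; rewrite eqxx.
  congr (_ * _); rewrite !sgnf_cm_cpr // -!size_filter fr.
  case: ifP => // _; congr (_ * _); apply: eq_sgn.
  - by apply: ml => // j; rewrite inE => /eqP ->.
  - exact: ml.
  - by rewrite !filter_cat fd fr.
have abba J' : J' != J -> odd #|J'| -> T [:: a] J' + T [:: b] J' - T [:: a; b] J' = 0.
  move=> J'J J'o; have [aJ'|aJ'] := boolP (a \in J'); have [bJ'|bJ'] := boolP (b \in J').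
  - have Tz p : T p J' = 0.
      have [sub|nsub] := boolP (J \subset J').
        rewrite /T big1 ?mulr0 // => j /andP[jJ' _]; apply: bigger => //.
        by rewrite properEneq eq_sym J'J.
      rewrite /T sgnf_cm_cpr //; case: ifP => [allC|]; last by rewrite mul0r.
      have kJ' : k \notin J'.
        apply: contra nsub => kJ'; apply/subsetP => j jJ.
        have [->//|ja] := eqVneq j a; have [->//|jb] := eqVneq j b.
        have : j \in k :: C by rewrite memE ja jb.
        by rewrite inE => /orP[/eqP->//|/(allP allC)].
      rewrite /= (negPf kJ') add0n (cnt_sub allC) -signr_odd oddM (negPf evC) andbF.
      by rewrite subrr mulr0 !mul0r.
    by rewrite !Tz addr0 subrr.
  - have [] := one J' a b ab _ _ aJ' bJ'; rewrite ?inE ?eqxx ?orbT // => -> ->.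
    by rewrite addr0 subrr.
  - have [] := one J' b a _ _ _ bJ' aJ'; rewrite ?inE ?eqxx ?orbT 1?eq_sym // => -> ->.
    by rewrite add0r subrr.
  - have Tz p : {subset p <= [:: a; b]} -> T p J' = 0.
      by move=> pab; apply: T0 => j /pab; rewrite !inE => /orP[] /eqP ->.
    by rewrite !Tz ?addr0 ?subrr // => j; rewrite !inE => /eqP ->; rewrite eqxx ?orbT.
move: sab; rewrite (bigD1 J) //= big1 ?addr0 => [|J' /andP[J'o J'J]]; last exact: abba.
have allC : all (mem J) C.
  by apply/allP => j jC; have := memE j; rewrite inE jC orbT => /esym /and3P[].
have cntE : odd (cnt J (k :: C)).
  have kJ : k \in J by have := memE k; rewrite mem_head => /esym /and3P[].
  by rewrite /= kJ cnt_sub // add1n /= evC.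
have restJ p : J :&: ~: (E :|: [set j in p]) = [set j in [:: a; b] | j \notin p].
  apply/setP => j; rewrite !inE; case: (j \in p); rewrite ?orbT ?andbF //= orbF andbT.
  have [->|ja] := eqVneq j a; first by rewrite aJ ab.
  have [->|jb] := eqVneq j b; first by rewrite bJ.
  by case: (j \in J).
have cntr p : cnt J (rest E p) = #|[set j in [:: a; b] | j \notin p]|.
  by rewrite -size_filter filter_enum_set -cardE restJ.
have set1ab d e : d != e -> [:: d; e] =i [:: a; b] ->
    T [:: d] J = 2 ^+ (size C)./2 * 2 *
      sgn K J ([:: d; e] ++ rest E [:: a; b] ++ k :: C) * c J d.
  move=> de deab.
  have dab : d \in [:: a; b] by rewrite -deab mem_head.
  have eab : e \in [:: a; b] by rewrite -deab !inE eqxx orbT.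
  have dJ : d \in J by move: dab; rewrite !inE => /orP[] /eqP ->.
  rewrite /T (sum2 [:: d] _ d) ?mem_head // => [|j]; last first.
    by rewrite inE => /eqP ->; rewrite eqxx.
  have re : [set j in [:: a; b] | j \notin [:: d]] = [set e].
    apply/setP => j; rewrite inE [_ \in [set e]]inE -deab !inE.
    by have [->|] := eqVneq j d; rewrite ?(negPf de) ?andbT.
  rewrite sgnf_cm_cpr // allC cntr re cards1 mul1n -signr_odd cntE expr1 opprK.
  congr (_ * _ * _); apply: eq_sgn.
  - by apply: ml => // j; rewrite inE => /eqP ->.
  - rewrite /multilin (permPl (_ : perm_eq _ ([:: a; b] ++ rest E [:: a; b] ++ k :: C))).
      by apply: (ml [:: a; b]) => //; rewrite /= inE ab.
    rewrite perm_cat2r; apply: uniq_perm => //; by rewrite /= inE ?de ?ab.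
  have eJ : e \in J by move: eab; rewrite !inE => /orP[] /eqP ->.
  rewrite !filter_cat !filter_enum_set !restJ re /= dJ eJ enum_set1.
  have -> : [set j in [:: a; b] | j \notin [:: a; b]] = set0.
    by apply/setP => j; rewrite !inE; case: (_ || _).
  by rewrite enum_set0.
have ba : b != a by rewrite eq_sym.
rewrite (set1ab a b ab) // (set1ab b a ba); last by move=> j; rewrite !inE orbC.
have -> : T [:: a; b] J = 0.
  rewrite /T sgnf_cm_cpr // allC cntr.
  have -> : [set j in [:: a; b] | j \notin [:: a; b]] = set0.
    by apply/setP => j; rewrite !inE; case: (_ || _).
  by rewrite cards0 mul0n expr0 subrr mulr0 !mul0r.
have := sgn_swap K J [::] [:: b] [:: a] (rest E [:: a; b] ++ k :: C).
rewrite /= aJ bJ expr1 subr0 => ->; set s := sgn _ _ _.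
have s0 : s != 0.
  rewrite /s /sgn ifT ?signr_eq0 //.
  by apply: (ml [:: a; b]) => //; rewrite /= inE ab.
rewrite (_ : _ + _ = 2 ^+ (size C)./2 * 2 * s * (c J a - c J b)); last by ring.
move/eqP; rewrite !mulf_eq0 expf_eq0 !((pcharf0P K).1 charK) andbF (negPf s0) /=.
by rewrite subr_eq0 => /eqP.
Qed.

End LowerBound.

(** * Counting *)

Lemma subspace_full (K : fieldType) (N : nat) (S : 'rV[K]_N -> Prop) :
  S 0 -> (forall k u v, S u -> S v -> S (k *: u + v)) ->
  (forall c : 'cV[K]_N, (forall u, S u -> u *m c = 0) -> c = 0) ->
  forall u, S u.
Proof.
move=> S0 SD orth.
have SA u v : S u -> S v -> S (u + v) by rewrite -[u in u + v]scale1r; apply: SD.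
pose good r := `[< exists M : 'M[K]_N,
  \rank M = r /\ forall u : 'rV_N, (u <= M)%MS -> S u >].
have exg : exists r, good r.
  exists 0%N; apply/asboolP; exists 0; split; first exact: mxrank0.
  by move=> u; rewrite submx0 => /eqP ->.
have bnd r : good r -> (r <= N)%N by move/asboolP=> [M [<- _]]; apply: rank_leq_row.
case: (ex_maxnP exg bnd) => r /asboolP[M [rM MS]] rmax.
have SM u : S u -> (u <= M)%MS.
  move=> Su; have : good (\rank (M + u)%MS).
    apply/asboolP; exists (M + u)%MS; split=> // v /sub_addsmxP[[a b] /= ->].
    apply: SA; first by apply: MS; apply: submxMl.
    by rewrite [b]mx11_scalar mul_scalar_mx -[_ *: u]addr0; apply: SD.
  move/rmax; rewrite -rM => le; apply: submx_trans (addsmxSr M u) _.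
  by rewrite -(geq_leqif (mxrank_leqif_sup (addsmxSl M u))).
have M0 : cokermx M = 0.
  apply/matrixP => i j; transitivity (col j (cokermx M) i 0); first by rewrite [RHS]mxE.
  rewrite (orth (col j (cokermx M))) ?[LHS]mxE ?[RHS]mxE // => u /SM /submxP[D ->].
  by rewrite colE mulmxA -(mulmxA D) mulmx_coker mulmx0 mul0mx.
by move=> u; apply: MS; rewrite submxE M0 mulmx0.
Qed.

Section Count.
Context (n : nat) (i0 : 'I_n).
Implicit Types (a b : 'I_n) (J : {set 'I_n}).

Definition anchor (J : {set 'I_n}) := odflt i0 [pick b in J].

Lemma anchor_in J b : b \in J -> anchor J \in J.
Proof. by rewrite /anchor; case: pickP => [//|->]. Qed.

Definition indices : {set {set 'I_n} * 'I_n} :=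
  [set x : {set 'I_n} * 'I_n | [&& odd #|x.1|, x.2 \in x.1 & x.2 != anchor x.1]].

Lemma card_toggle (P Q : pred {set 'I_n}) (a : 'I_n) :
  (forall J, P J = Q (if a \in J then J :\ a else a |: J)) ->
  #|[set J : {set 'I_n} | P J]| = #|[set J : {set 'I_n} | Q J]|.
Proof.
pose t (J : {set 'I_n}) := if a \in J then J :\ a else a |: J => PQ.
have tK : involutive t.
  move=> J; rewrite /t; case: (boolP (a \in J)) => aJ.
    by rewrite !inE eqxx /= setD1K.
  by rewrite !inE eqxx /= setU1K.
rewrite -[RHS](card_preimset _ (inv_inj tK)); apply: eq_card => J.
by rewrite !inE PQ.
Qed.

Lemma odd_toggle (J : {set 'I_n}) a :
  odd #|if a \in J then J :\ a else a |: J| = ~~ odd #|J|.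
Proof.
case: ifP => aJ; last by rewrite cardsU1 aJ oddD.
by rewrite [in RHS](cardsD1 a) aJ oddD negbK.
Qed.

Lemma card_odd : (#|[set J : {set 'I_n} | odd #|J| ]|).*2 = (2 ^ n)%N.
Proof.
rewrite -addnn.
have e : #|[set J : {set 'I_n} | odd #|J|]| = #|[set J : {set 'I_n} | ~~ odd #|J|]|.
  by apply: (@card_toggle _ _ i0) => J; rewrite odd_toggle negbK.
rewrite {2}e (_ : [set J : {set 'I_n} | ~~ odd #|J|] = ~: [set J : {set 'I_n} | odd #|J|]).
  by rewrite cardsC -cardsT -powersetT card_powerset cardsT card_ord.
by apply/setP => J; rewrite !inE.
Qed.

Lemma card_odd_in (b : 'I_n) : (1 < n)%N ->
  (#|[set J : {set 'I_n} | odd #|J| && (b \in J)]| * 4 = 2 ^ n)%N.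
Proof.
move=> n1; have [a ab] : exists a : 'I_n, a != b.
  have [] := eqVneq b (Ordinal (ltnW n1)) => [->|nb].
    by exists (Ordinal n1).
  by exists (Ordinal (ltnW n1)); rewrite eq_sym.
pose T := [set J : {set 'I_n} | b \in J].
have e1 : #|T| = #|[set J : {set 'I_n} | b \notin J]|.
  apply: (@card_toggle _ _ b) => J; case: ifP => bJ; rewrite !inE eqxx //.
have e2 : #|[set J : {set 'I_n} | odd #|J| && (b \in J)]| =
          #|[set J : {set 'I_n} | ~~ odd #|J| && (b \in J)]|.
  apply: (@card_toggle _ _ a) => J; rewrite odd_toggle negbK.
  by congr (_ && _); case: ifP; rewrite !inE eq_sym ?(negPf ab).
have t1 : (#|T| + #|T| = 2 ^ n)%N.
  rewrite {2}e1 (_ : [set J : {set 'I_n} | b \notin J] = ~: T).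
    by rewrite cardsC -cardsT -powersetT card_powerset cardsT card_ord.
  by apply/setP => J; rewrite !inE.
have t2 : (#|[set J : {set 'I_n} | odd #|J| && (b \in J)]| +
           #|[set J : {set 'I_n} | ~~ odd #|J| && (b \in J)]| = #|T|)%N.
  rewrite -(cardsID [set J : {set 'I_n} | odd #|J|] T).
  congr (_ + _)%N; apply: eq_card => J;
   by rewrite !inE // andbC.
by move: t1 t2; rewrite -e2; lia.
Qed.

Lemma card_indices : (1 < n)%N -> #|indices| = ((n - 2) * 2 ^ (n - 2))%N.
Proof.
move=> n1.
have e1 : #|indices| = (\sum_(J : {set 'I_n} | odd #|J|) (#|J| - 1))%N.
  rewrite -sum1_card (eq_bigl (fun x : {set 'I_n} * 'I_n =>
    odd #|x.1| && [&& true, x.2 \in x.1 & x.2 != anchor x.1])); last first.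
    by move=> x; rewrite inE.
  rewrite -(pair_big_dep (fun J : {set 'I_n} => odd #|J|)
    (fun J b => [&& true, b \in J & b != anchor J]) (fun _ _ => 1%N)) /=.
  apply: eq_bigr => J Jo; rewrite sum1_card.
  have aJ : anchor J \in J.
    have /card_gt0P[b bJ] : (0 < #|J|)%N by case: #|J| Jo.
    exact: anchor_in bJ.
  rewrite (cardsD1 (anchor J) J) aJ add1n subn1 /=.
  by apply: eq_card => b; rewrite !inE andbC.
have e2 : (\sum_(J : {set 'I_n} | odd #|J|) (#|J| - 1) +
          #|[set J : {set 'I_n} | odd #|J| ]| =
          \sum_(b : 'I_n) #|[set J : {set 'I_n} | odd #|J| && (b \in J)]|)%N.
  rewrite -sum1_card (eq_bigl (fun J : {set 'I_n} => odd #|J|) (fun _ => 1%N))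
    => [|J]; last by rewrite inE.
  rewrite -big_split /= (eq_bigr (fun J : {set 'I_n} => \sum_(b in J) 1)%N)
    => [|J Jo]; last first.
    by rewrite sum1_card subnK //; case: #|J| Jo.
  rewrite (exchange_big_dep predT) //=; apply: eq_bigr => b _.
  by rewrite -sum1_card; apply: eq_bigl => J; rewrite inE.
have e3 : ((\sum_(b : 'I_n) #|[set J : {set 'I_n} | odd #|J| && (b \in J)]|) * 4 =
           n * 2 ^ n)%N.
  rewrite big_distrl /= (eq_bigr (fun=> 2 ^ n)%N) => [|b _]; last exact: card_odd_in.
  by rewrite sum_nat_const card_ord.
have := card_odd; rewrite e1; move: e2 e3.
have [m ->] : exists m, n = m.+2 by exists (n - 2)%N; lia.
rewrite !expnS subSS subSS subn0 -muln2.
set x := (\sum_(J | _) _)%N; set y := #|_|; set z := (\sum_b _)%N; set p := (2 ^ m)%N.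
nia.
Qed.
End Count.

(** * The basis of B_3 *)

Section Main.
Context (K : fieldType) (charK : [pchar K] =i pred0).
Context (n : nat) (A : algType K) (F : wordBasis n A) (i0 : 'I_n).
Local Notation W := (wd F).
Implicit Types (p q u v w z : seq 'I_n) (a b : 'I_n) (J : {set 'I_n}).
Implicit Types (x y : A).

Lemma idxf_lcs4 J b x : odd #|J| -> x \in lcs 4 -> idxf F J b x = 0.
Proof.
move=> Jo; move: x; apply: lcs_ind => [|k x y IHx IHy|a x xL].
- by rewrite raddf0.
- by rewrite linearP IHx IHy /= scaler0 addr0.
apply: (cm_wd_ind (F := F) (P := fun y => idxf F J b y = 0)) => [|k y z IHy IHz|u].
- by rewrite raddf0.
- by rewrite linearP IHy IHz /= scaler0 addr0.
have := sgnf_lcs3 F J u [::] xL; rewrite wd_nil mulr1 => e.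
by rewrite idxf_cm // e mulr0.
Qed.

Lemma idxf_mlproj J b x : idxf F J b (mlproj F x) = idxf F J b x.
Proof.
elim/(wd_ind F): x => [|k w x IH]; first by rewrite !raddf0.
rewrite (linearP (mlproj F)) !(linearP (idxf F J b)) IH !lext_wd.
congr (_ *: _ + _); case: ifP => ml; first by rewrite lext_wd.
by rewrite raddf0 /sgn ml mul0r.
Qed.

Lemma mlproj_idem x : mlproj F (mlproj F x) = mlproj F x.
Proof.
elim/(wd_ind F): x => [|k w x IH]; first by rewrite !raddf0.
rewrite !(linearP (mlproj F)) IH lext_wd.
by case: ifP => ml; rewrite ?raddf0 // lext_wd ml.
Qed.

Lemma mlproj_lcs3 x : x \in lcs 3 -> mlproj F x \in lcs 3.
Proof.
move: x; apply: (lcs3_wd_ind (F := F)) => [|k x y IHx IHy|u v w].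
- by rewrite raddf0 rpred0.
- by rewrite linearP rpredD ?rpredZ.
have mlE s : perm_eq s (u ++ v ++ w) -> mlproj F (W s) =
    if multilin (u ++ v ++ w) then W s else 0.
  by move=> su; rewrite lext_wd /multilin (permPl su).
suff -> : mlproj F (cm (W u) (cm (W v) (W w))) =
    if multilin (u ++ v ++ w) then cm (W u) (cm (W v) (W w)) else 0.
  by case: ifP => _; [do 2 apply: mem_lcs; rewrite // /lcs | exact: rpred0].
have -> : cm (W u) (cm (W v) (W w)) =
    W (u ++ v ++ w) - W (u ++ w ++ v) - (W (v ++ w ++ u) - W (w ++ v ++ u)).
  by rewrite !wd_cat /cm !(mulrBl, mulrBr, mulrA); zmod.
rewrite !raddfB /= !mlE; try by apply/permP => q; rewrite !count_cat; lia.
by case: ifP => _ //; rewrite subrr add0r subrr.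
Qed.

Local Notation d := #|indices i0|.

Definition coord x (j : 'I_d) : K :=
  let: (J, b) := enum_val j in idxf F J b x - idxf F J (anchor i0 J) x.

Lemma coordP k x y j : coord (k *: x + y) j = k * coord x j + coord y j.
Proof.
rewrite /coord; case: (enum_val j) => J b.
rewrite !(linearP (idxf F J _)) -!/(_ * _); rewrite /GRing.scale /=; ring.
Qed.

Lemma coord_sum (c : 'I_d -> K) (e : 'I_d -> A) j :
  coord (\sum_i c i *: e i) j = \sum_i c i * coord (e i) j.
Proof.
elim/big_rec2: _ => [|i s t _ <-]; last exact: coordP.
by rewrite /coord; case: (enum_val j) => J b; rewrite !raddf0 ?subrr ?addr0.
Qed.

Lemma coord_lcs4 x j : x \in lcs 4 -> coord x j = 0.
Proof.
move=> xL; have := enum_valP j; rewrite /coord inE; case: (enum_val j) => J b /=.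
by move=> /and3P[Jo _ _]; rewrite !idxf_lcs4 ?subrr.
Qed.

Lemma lcs4_coord x : x \in lcs 3 -> mlproj F x = x -> (forall j, coord x j = 0) ->
  x \in lcs 4.
Proof.
move=> xL xml x0; apply: (lcs4_of_idxf charK i0 xL xml).
suff anch J b : odd #|J| -> b \in J -> idxf F J b x = idxf F J (anchor i0 J) x.
  by move=> J b c Jo bJ cJ; rewrite !anch.
move=> Jo bJ; have [->//|ba] := eqVneq b (anchor i0 J).
have Db : (J, b) \in indices i0 by rewrite inE /= Jo bJ.
have := x0 (enum_rank_in Db (J, b)); rewrite /coord enum_rankK_in //.
by move/eqP; rewrite subr_eq0 => /eqP.
Qed.

Lemma coord_indep (c : 'I_d -> K) :
  (forall x, x \in lcs 3 -> \sum_j coord x j * c j = 0) -> forall j, c j = 0.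
Proof.
move=> c0.
pose g (t : {set 'I_n} * 'I_n) := \sum_(j | enum_val j == t) c j.
have gE j : g (enum_val j) = c j.
  rewrite /g (eq_bigl (pred1 j)) ?big_pred1_eq // => i.
  by rewrite /= (inj_eq enum_val_inj).
pose f J b := if b == anchor i0 J
  then - \sum_(a in J | a != anchor i0 J) g (J, a) else g (J, b).
have split_f J (h : 'I_n -> K) : odd #|J| -> \sum_(b in J) f J b * h b =
    \sum_(b in J | b != anchor i0 J) g (J, b) * (h b - h (anchor i0 J)).
  move=> Jo; have aJ : anchor i0 J \in J.
    have /card_gt0P[b bJ] : (0 < #|J|)%N by case: #|J| Jo.
    exact: anchor_in bJ.
  rewrite (bigD1 (anchor i0 J)) //= {1}/f eqxx.
  under eq_bigr => b /andP[_ /negPf nb] do rewrite /f nb.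
  rewrite mulNr mulr_suml addrC -sumrB; apply: eq_bigr => b _.
  by rewrite mulrBr.
have f_zero J b : odd #|J| -> b \in J -> f J b = 0.
  apply: (idxf_independent charK (F := F)) => {J b} [J Jo|x xL].
    have := split_f J (fun=> 1) Jo; under eq_bigr do rewrite mulr1.
    by move=> ->; rewrite big1 // => b _; rewrite subrr mulr0.
  under eq_bigr => J Jo do rewrite (split_f J (fun b => idxf F J b x)) //.
  rewrite -[RHS](c0 x xL) (pair_big_dep (fun J : {set 'I_n} => odd #|J|)
    (fun J b => (b \in J) && (b != anchor i0 J))
    (fun J b => g (J, b) * (idxf F J b x - idxf F J (anchor i0 J) x))) /=.
  rewrite (eq_bigl (mem (indices i0))) => [|t]; last by rewrite !inE.
  rewrite big_enum_val /=; apply: eq_bigr => j _.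
  by rewrite -surjective_pairing gE /coord mulrC; case: (enum_val j).
move=> j; rewrite -gE; have := enum_valP j; rewrite inE.
case: (enum_val j) => J b /= /and3P[Jo bJ ba].
by have := f_zero J b Jo bJ; rewrite /f (negPf ba).
Qed.

Lemma lcs3_mod_lcs4_basis : exists e : 'I_d -> A,
  [/\ forall i, e i \in lcs 3 /\ mlproj F (e i) = e i,
      forall c : 'I_d -> K, \sum_i c i *: e i \in lcs 4 -> forall i, c i = 0
    & forall x, x \in lcs 3 -> mlproj F x = x ->
        exists c : 'I_d -> K, x - \sum_i c i *: e i \in lcs 4].
Proof.
pose S (u : 'rV[K]_d) := exists x,
  [/\ x \in lcs 3, mlproj F x = x & u = \row_j coord x j].
have full : forall r : 'rV[K]_d, S r.
  apply: subspace_full => [|k _ _ [x [xL xml ->]] [y [yL yml ->]]|c orth].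
  - exists 0; rewrite rpred0 raddf0; split=> //; apply/rowP => j; rewrite !mxE.
    by rewrite coord_lcs4 ?rpred0.
  - exists (k *: x + y); rewrite rpredD ?rpredZ // linearP xml yml; split=> //.
    by apply/rowP => j; rewrite !mxE coordP.
  suff c0 j : c j 0 = 0 by apply/colP => j; rewrite c0 mxE.
  apply: (@coord_indep (fun j => c j 0)) => x xL.
  have Sx : S (\row_j coord (mlproj F x) j).
    by exists (mlproj F x); rewrite mlproj_lcs3 // mlproj_idem.
  have /matrixP/(_ 0 0) := orth _ Sx; rewrite !mxE => e; rewrite -[RHS]e.
  apply: eq_bigr => i _; rewrite mxE; congr (_ * _).
  by rewrite /coord; case: (enum_val i) => J b; rewrite !idxf_mlproj.
have [e eP] := boolp.choice (fun i : 'I_d => full (delta_mx 0 i)).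
have eC i j : coord (e i) j = (i == j)%:R.
  have [_ _ /rowP/(_ j)] := eP i.
  by rewrite !mxE eqxx eq_sym => ->.
have cE c j : coord (\sum_i c i *: e i) j = c j.
  rewrite coord_sum (bigD1 j) //= eC eqxx mulr1 big1 ?addr0 // => i /negPf ij.
  by rewrite eC ij mulr0.
exists e; split.
- by move=> i; have [] := eP i.
- by move=> c cL i; rewrite -cE coord_lcs4.
move=> x xL xml; exists (coord x); apply: lcs4_coord.
- apply: rpredB => //; apply: rpred_sum => i _; apply: rpredZ.
  by have [] := eP i.
- rewrite raddfB /= xml raddf_sum; congr (_ - _); apply: eq_bigr => i _.
  by rewrite /= linearZ; have [_ -> _] := eP i.
move=> j; rewrite -[x in coord (x - _)]scale1r addrC -scaleN1r coordP cE.
have -> : coord (1 *: x) j = coord x j by rewrite scale1r.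
by rewrite mulN1r addNr.
Qed.

End Main.

Section Transfer.
Context (K : fieldType) (n : nat).

Lemma L_lcs m : L K n m = @lcs K (freealg K n) m.
Proof. by elim: m => [|[|m] IH] //=; rewrite IH. Qed.

Lemma multilinE (w : seq 'I_n) :
  multilin w = [forall i, count_mem i w == 1%N].
Proof.
apply/idP/forallP => [ml i|w1].
  by rewrite count_uniq_mem ?(multilin_mem _ ml) // (multilin_uniq ml).
apply/allP => i _ /=; rewrite (eqP (w1 i)).
by rewrite count_uniq_mem ?enum_uniq // mem_enum.
Qed.

Lemma homogE (a : freealg K n) :
  (a \in homog (fun=> 1%N)) <-> mlproj (free_basis K n) a = a.
Proof.
have homE : (a \in homog (fun=> 1%N)) =
    all (fun w : {fmonom 'I_n} => multilin w) (msupp (a : {malg K[{fmonom 'I_n}]})).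
  by apply: eq_all => w; rewrite multilinE.
have coef (w : {fmonom 'I_n}) (b : freealg K n) :
    mcoeff w (mlproj (free_basis K n) b : {malg K[{fmonom 'I_n}]}) =
    if multilin w then mcoeff w (b : {malg K[{fmonom 'I_n}]}) else 0.
  elim/(wd_ind (free_basis K n)): b => [|k u b IH].
    by rewrite raddf0 mcoeff0; case: ifP.
  rewrite linearP lext_wd mcoeffD mcoeffZ IH [in RHS]mcoeffD mcoeffZ.
  rewrite [wd _ u]/(fwd K u) /fwd mcoeffU1.
  have [<-|uw] := eqVneq (FMonom u) w.
    by case: ifP => /= ml; rewrite ?ml ?mcoeffU1 ?eqxx ?mcoeff0 ?mulr0 ?addr0.
  case: ifP => mu; case: ifP => mw; rewrite ?mcoeff0 ?mcoeffU1 ?(negPf uw) ?mulr0 ?addr0 //.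
rewrite homE; split=> [/allP aml|ma].
  apply/malgP => w; rewrite coef; case: ifP => // /negP ml.
  by apply/esym/mcoeff_outdom/negP => /aml.
apply/allP => w; rewrite -mcoeff_neq0 -ma coef.
by case: ifP => //; rewrite eqxx.
Qed.

End Transfer.

Theorem corollary1p9 (K : fieldType) (charK : [pchar K] =i pred0)
    (n : nat) (hn : (2 <= n)%N) :
  has_dim (Bdeg K n 3 (fun=> 1%N)) ((n - 2) * 2 ^ (n - 2))%N.
Proof.
pose i0 : 'I_n := Ordinal (ltnW hn).
rewrite -(card_indices i0 hn).
have [e [eL indep span]] := lcs3_mod_lcs4_basis charK (free_basis K n) i0.
have qE (v : freealg K n) : (qproj (L K n 4) v == 0) = (v \in lcs 4).
  by rewrite qproj_eq0 L_lcs.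
have qS (c : 'I_#|indices i0| -> K) : \sum_i c i *: qproj (L K n 4) (e i) =
    qproj (L K n 4) (\sum_i c i *: e i).
  by rewrite raddf_sum; apply: eq_bigr => i _; rewrite /= linearZ.
exists (fun i => qproj (L K n 4) (e i)); split.
- move=> i; have [eiL eiml] := eL i; apply/asboolP; exists (e i) => //.
  by apply/andP; split; [rewrite L_lcs | apply/homogE].
- by move=> c; rewrite qS => /eqP; rewrite qE => /indep.
move=> _ /asboolP[u /andP[uL uh] ->].
have [||c cL] := span u; [by rewrite -L_lcs | by apply/homogE|].
by exists c; rewrite qS; apply/eqP; rewrite -subr_eq0 -raddfB qE.
Qed.
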